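(* Let $E$ be a locally complete locally convex Hausdorff space over $\mathbb{C}$ and $\Omega\subset\mathbb{C}^{d}$ open. Then the following statements are equivalent for a function $f\colon\Omega\to E$. a) $f$ is holomorphic on $\Omega$. b) $f\in\mathcal{C}^{\infty}_{\mathbb{C}}(\Omega,E)$.
   Context: $E$ is a non-trivial locally convex Hausdorff space with completion $\widehat{E}$. For a bounded, absolutely convex set (disk) $D\subset E$ put $E_D:=\bigcup_{n\in\mathbb{N}}nD$ normed by the gauge of $D$; $E$ is locally complete if $E_D$ is a Banach space for every closed disk $D$. $f\colon\Omega\to E$ is holomorphic if for every $z\in\Omega$ there is a $\mathbb{C}$-linear map $df(z)\colon\mathbb{C}^d\to\widehat{E}$ with $\lim_{w\to z,\,w\in\Omega,\,w\ne z}\frac{f(w)-f(z)-df(z)[w-z]}{|w-z|}=0$ in $\widehat{E}$, and $df(\cdot)[v]\colon\Omega\to\widehat{E}$ is continuous for every $v\in\mathbb{C}^d$. $(\partial^{e_j}_{\mathbb{C}})^{E}f(z):=\lim_{h\to0,\,h\in\mathbb{C}\setminus\{0\}}\frac{f(z+he_j)-f(z)}{h}$ if the limit exists in $E$ ($e_j$ the $j$th unit vector). $f\in\mathcal{D}^{1}_{\mathbb{C}}(\Omega,E)$ means that $(\partial^{e_j}_{\mathbb{C}})^Ef(z)$ exists in $E$ for all $z\in\Omega$ and $1\le j\le d$; $f\in\mathcal{D}^{k}_{\mathbb{C}}(\Omega,E)$ ($k\ge2$) means $f\in\mathcal{D}^1_{\mathbb{C}}(\Omega,E)$ and all first complex partial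 derivatives of $f$ are in $\mathcal{D}^{k-1}_{\mathbb{C}}(\Omega,E)$; $\mathcal{D}^{\infty}_{\mathbb{C}}(\Omega,E)=\bigcap_{k}\mathcal{D}^{k}_{\mathbb{C}}(\Omega,E)$. $\mathcal{C}^{\infty}_{\mathbb{C}}(\Omega,E)$ is the subspace of $\mathcal{D}^{\infty}_{\mathbb{C}}(\Omega,E)$ of all functions such that all complex partial derivatives of any order (including order $0$, the function itself) are continuous on $\Omega$. *)

(* Defs.v *)
From HB Require Import structures.
From mathcomp Require Import all_boot all_order all_algebra.
From mathcomp Require Import complex.
From mathcomp Require Import all_classical all_reals all_analysis.

Set Implicit Arguments.
Unset Strict Implicit.
Unset Printing Implicit Defensive.

Import Order.TTheory GRing.Theory Num.Theory.
Import numFieldNormedType.Exports.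

Local Open Scope classical_set_scope.
Local Open Scope ring_scope.

(* The field of complex numbers, typed so that it receives the topology the
   library puts on every [numClosedFieldType]. Its order is partial:
   [0 < r] in [Cplx R] says that [r] is real and positive. *)
Definition Cplx (R : realType) : numClosedFieldType := R[i]%C.

Section LocallyConvex.
Context {R : realType}.
Implicit Types E F : tvsType (Cplx R).

Definition absolutely_convex E (D : set E) : Prop :=
  forall (a b : Cplx R) (x y : E),
    `|a| + `|b| <= 1 -> D x -> D y -> D (a *: x + b *: y).

Definition tvs_bounded E (D : set E) : Prop :=
  forall U : set E, nbhs 0 U ->
    exists2 r : Cplx R, 0 < r & D `<=` ( *:%R r @` U).

Definition disk E (D : set E) : Prop :=
  [/\ D !=set0, tvs_bounded D & absolutely_convex D].

Definition disk_span E (D : set E) : set E :=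
  \bigcup_(n : nat) ( *:%R n%:R @` D).

Definition gauge E (D : set E) (x : E) : R :=
  inf [set t : R | 0 < t /\ ( *:%R (t%:C%C : Cplx R) @` D) x].

(* For a disk D in a Hausdorff space the gauge is a norm on [disk_span D], so
   being a Banach space amounts to the convergence of Cauchy sequences. *)
Definition disk_span_banach E (D : set E) : Prop :=
  forall u : nat -> E, (forall n, disk_span D (u n)) ->
    (forall eps : R, 0 < eps -> exists N : nat, forall m n : nat,
       (N <= m)%N -> (N <= n)%N -> gauge D (u m - u n) < eps) ->
    exists2 x : E, disk_span D x &
      forall eps : R, 0 < eps -> exists N : nat, forall n : nat,
        (N <= n)%N -> gauge D (u n - x) < eps.

Definition locally_complete E : Prop :=
  forall D : set E, disk D -> closed D -> disk_span_banach D.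

(* The uniform structure carried by a [tvsType] is only required to induce the
   topology, so [cauchy] and [completeType] need not be about the uniformity of
   the topological group. Completeness is therefore stated with differences. *)
Definition tvs_cauchy E (G : set_system E) : Prop :=
  p.1 - p.2 @[p --> (G, G)] --> (0 : E).

Definition tvs_complete E : Prop :=
  forall G : set_system E, ProperFilter G -> tvs_cauchy G ->
    exists x : E, G --> x.

(* [i : E -> F] exhibits F as the completion of E, which is unique up to an
   isomorphism over E. *)
Definition is_completion E F (i : {linear E -> F}) : Prop :=
  [/\ hausdorff_space F,
      tvs_complete F,
      injective i,
      forall U : set E, open U <-> exists2 V : set F, open V & i @^-1` V = U
    & dense (range i)].

End LocallyConvex.

(* A function on an open set Omega is represented by a total function of which
   only the values on Omega matter. *)
Section SeveralVariables.
Context {R : realType} {d : nat}.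
Implicit Types (E F : tvsType (Cplx R)) (Omega : set 'rV[Cplx R]_d).

Definition euclidean_norm (v : 'rV[Cplx R]_d) : Cplx R :=
  sqrtC (\sum_(j < d) `|v 0 j| ^+ 2).

Definition holomorphic E F (i : {linear E -> F}) Omega (f : 'rV[Cplx R]_d -> E)
    : Prop :=
  exists df : 'rV[Cplx R]_d -> {linear 'rV[Cplx R]_d -> F},
    (forall z, Omega z ->
       (euclidean_norm (w - z))^-1 *: (i (f w) - i (f z) - df z (w - z))
         @[w --> within [set w | Omega w /\ w != z] (nbhs z)] --> (0 : F)) /\
    (forall v, {within Omega, continuous (fun z => df z v)}).

Definition partial_quot E (j : 'I_d) (f : 'rV[Cplx R]_d -> E)
    (z : 'rV[Cplx R]_d) (h : Cplx R) : E :=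
  h^-1 *: (f (z + h *: delta_mx 0 j) - f z).

Definition has_partial E (j : 'I_d) (f : 'rV[Cplx R]_d -> E)
    (z : 'rV[Cplx R]_d) : Prop :=
  exists l : E, partial_quot j f z h @[h --> (0 : Cplx R)^'] --> l.

(* The limit, with value 0 where it does not exist; [cvg] and [lim] are not
   available since a [tvsType] is not pointed. *)
Definition partial E (j : 'I_d) (f : 'rV[Cplx R]_d -> E)
    (z : 'rV[Cplx R]_d) : E :=
  xget 0 [set l : E | partial_quot j f z h @[h --> (0 : Cplx R)^'] --> l].

(* Only k >= 1 is meaningful; k = 0 imposes nothing and starts the recursion. *)
Fixpoint in_D E Omega (k : nat) (f : 'rV[Cplx R]_d -> E) : Prop :=
  match k with
  | 0 => True
  | k'.+1 => (forall z j, Omega z -> has_partial j f z) /\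
             (forall j, in_D Omega k' (partial j f))
  end.

Definition in_Dinfty E Omega (f : 'rV[Cplx R]_d -> E) : Prop :=
  forall k : nat, in_D Omega k f.

Definition iter_partial E (js : seq 'I_d) (f : 'rV[Cplx R]_d -> E)
    : 'rV[Cplx R]_d -> E :=
  foldr (@partial E) f js.

Definition in_Cinfty E Omega (f : 'rV[Cplx R]_d -> E) : Prop :=
  in_Dinfty Omega f /\
  forall js : seq 'I_d, {within Omega, continuous (iter_partial js f)}.

End SeveralVariables.

(* Main.v *)
From HB Require Import structures.
Require Import Defs.
From mathcomp Require Import all_boot all_order all_algebra.
From mathcomp Require Import complex lra ring.
From mathcomp Require Import all_classical all_reals all_analysis.
Import Order.TTheory GRing.Theory Num.Theory.
Import numFieldNormedType.Exports.
Set Implicit Arguments.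
Unset Strict Implicit.
Unset Printing Implicit Defensive.
Local Open Scope classical_set_scope.
Local Open Scope ring_scope.

(** The heart of the matter is the passage from holomorphic to smooth functions,
    where local completeness enters through one estimate. Fix an axis and a point [z],
    and let [u x] be the value of [f] at [z] displaced by the complex number [x] along
    the axis. The difference
    quotients [q h = (u h - u 0) / h] satisfy [q h - q h' = (h - h') s(h, h')] with
    [s] the second divided difference. If the vectors [s(h, h')] form a bounded set of
    [E], they lie in a closed disk [D], so [q] is Lipschitz, hence Cauchy at zero, in
    the Banach space spanned by [D]; the partial derivative then exists in [E] itself
    ([locally_complete_diff_quot]). Boundedness is tested on continuous seminorms,
    and for each of them it is a Cauchy estimate: [s] is at most [4 M / r ^ 2] when
    [u] is at most [M] on the disc of radius [r] and [h], [h'] lie in the disc of radius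
    [r / 2] ([cauchy_estimate]).

    The Cauchy estimate is proved without integrals. The Cauchy integral is replaced
    by the average of [u] against the Cauchy kernel over the [N]-th roots of unity of
    a circle. Contracting the circle to the pole changes this average at a rate which
    is a Riemann sum of the derivative of [u] along a closed polygon; as [u] is
    uniformly differentiable on the disc, that sum is close to a telescoping sum equal
    to zero, so the mean value inequality shows that the average is close to the value
    of [u] at the pole ([cauchy_avg_near]). The argument only asks for
    primitive roots of unity arbitrarily close to one ([small_prim_root]), which
    repeated square roots provide, and it works for each seminorm separately.

    A holomorphic function has, in the completion, continuous partial derivatives
    ([holomorphic_C1]); by the above they come from partial derivatives in [E]
    ([has_C1_descend]). To iterate, one shows that the partial derivatives of a
    continuously differentiable function are continuously differentiable
    ([has_C1_partial]): a partial derivative is the limit, uniform on discs, of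
    difference quotients of [f], which obey the Cauchy estimate, and this estimate
    survives such limits ([cauchy_estimate_limit]).

    Conversely, by the mean value inequality continuity of the partial derivatives
    makes the increments of [f] along axes uniformly linear ([strict_partial]);
    joining two points by a path of segments parallel to the axes gives the total
    derivative ([C1_holomorphic]). *)

(** * The modulus of a complex number as a real number *)

Section Modulus.
Context {R : realType}.
Implicit Types a b : Cplx R.

(** The norm of [Cplx R] takes values in [Cplx R], whose order is only partial;
    estimates are carried out in [R]. *)
Definition modulus a : R := complex.Re `|a|.
Definition toC (t : R) : Cplx R := t%:C%C.

Lemma normE a : `|a| = toC (modulus a).
Proof. by rewrite /modulus /toC normc_def. Qed.

Lemma toCD s t : toC (s + t) = toC s + toC t. Proof. exact: (rmorphD (real_complex R)). Qed.
Lemma toCB s t : toC (s - t) = toC s - toC t. Proof. exact: (rmorphB (real_complex R)). Qed.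
Lemma toCM s t : toC (s * t) = toC s * toC t. Proof. exact: (rmorphM (real_complex R)). Qed.
Lemma toC0 : toC 0 = 0 :> Cplx R. Proof. by []. Qed.
Lemma toC1 : toC 1 = 1 :> Cplx R. Proof. by []. Qed.
Lemma toCV s : toC s^-1 = (toC s)^-1. Proof. exact: (fmorphV (real_complex R)). Qed.
Lemma toC_inj : injective toC. Proof. exact: complexI. Qed.
Lemma toC_le s t : (toC s <= toC t) = (s <= t). Proof. exact: lecR. Qed.
Lemma toC_lt s t : (toC s < toC t) = (s < t). Proof. exact: ltcR. Qed.
Lemma toC_nat n : toC n%:R = n%:R. Proof. exact: (rmorph_nat (real_complex R)). Qed.

Lemma toCP (e : Cplx R) : 0 < e -> exists2 t : R, 0 < t & e = toC t.
Proof.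
move=> e0; have er : toC (complex.Re e) = e by apply: RRe_real; exact: gtr0_real.
by exists (complex.Re e); rewrite ?er// -toC_lt er.
Qed.

Lemma modulus_ge0 a : 0 <= modulus a.
Proof. by rewrite -toC_le -normE normr_ge0. Qed.
Lemma modulus0 : modulus 0 = 0. Proof. by apply: toC_inj; rewrite -normE normr0. Qed.
Lemma modulus1 : modulus 1 = 1. Proof. by apply: toC_inj; rewrite -normE normr1. Qed.
Lemma modulus0_eq0 a : modulus a = 0 -> a = 0.
Proof. by move=> h; apply/eqP; rewrite -normr_eq0 normE h toC0. Qed.
Lemma modulus_gt0 a : a != 0 -> 0 < modulus a.
Proof.
by move=> a0; rewrite lt0r modulus_ge0 andbT; apply: contra_neq a0 => /modulus0_eq0.
Qed.
Lemma modulusM a b : modulus (a * b) = modulus a * modulus b.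
Proof. by apply: toC_inj; rewrite toCM -!normE normrM. Qed.
Lemma modulusD a b : modulus (a + b) <= modulus a + modulus b.
Proof. by rewrite -toC_le toCD -!normE ler_normD. Qed.
Lemma modulusN a : modulus (- a) = modulus a.
Proof. by rewrite /modulus normrN. Qed.
Lemma modulusBC a b : modulus (a - b) = modulus (b - a).
Proof. by rewrite -modulusN opprB. Qed.
Lemma modulusB a b : modulus (a - b) <= modulus a + modulus b.
Proof. by rewrite -[modulus b]modulusN modulusD. Qed.
Lemma modulusV a : modulus a^-1 = (modulus a)^-1.
Proof. by apply: toC_inj; rewrite toCV -!normE normfV. Qed.
Lemma modulusX a n : modulus (a ^+ n) = modulus a ^+ n.
Proof. by elim: n => [|n ih]; rewrite ?expr0 ?modulus1// !exprS modulusM ih. Qed.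
Lemma modulus_toC t : modulus (toC t) = `|t|.
Proof. by apply: toC_inj; rewrite -normE /toC normc_def/= expr0n addr0 sqrtr_sqr. Qed.
Lemma modulus_toC_ge0 t : 0 <= t -> modulus (toC t) = t.
Proof. by move=> t0; rewrite modulus_toC ger0_norm. Qed.

Lemma modulus_toC_gt0 t : 0 < t -> modulus (toC t) = t.
Proof. by move=> /ltW /modulus_toC_ge0. Qed.
Lemma toC_neq0 t : 0 < t -> toC t != 0.
Proof. by move=> t0; rewrite gt_eqF// -toC0 toC_lt. Qed.

Lemma nbhs_cplxP (x : Cplx R) (A : set (Cplx R)) :
  nbhs x A <-> exists2 e : R, 0 < e & forall y, modulus (y - x) < e -> A y.
Proof.
rewrite -nbhs_ballE; split=> [[e /toCP[t t0 ->] h]|[e e0 h]].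
  by exists t => // y yx; apply: h; rewrite -ball_normE /= normE toC_lt modulusBC.
exists (toC e); first by rewrite /= -toC0 toC_lt.
by move=> y; rewrite -ball_normE /= normE toC_lt modulusBC; exact: h.
Qed.

Lemma nbhs_rvP d (x : 'rV[Cplx R]_d) (A : set 'rV[Cplx R]_d) :
  nbhs x A <-> exists2 e : R, 0 < e &
    forall y : 'rV[Cplx R]_d, (forall j, modulus (y 0 j - x 0 j) < e) -> A y.
Proof.
rewrite -nbhs_ballE; split=> [[e /toCP[t t0 ->] h]|[e e0 h]].
  exists t => // y yx; apply: h; split; first by rewrite -toC0 toC_lt.
  by move=> i j; rewrite (ord1 i) -ball_normE /= normE toC_lt modulusBC.
exists (toC e); first by rewrite /= -toC0 toC_lt.
move=> y [_ yx]; apply: h => j.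
by have := yx 0 j; rewrite -ball_normE /= normE toC_lt modulusBC.
Qed.
End Modulus.

(** * Continuous seminorms of a locally convex space *)

Section Seminorms.
Context {R : realType}.
Implicit Types E : tvsType (Cplx R).

Definition seminorm E (p : E -> R) : Prop :=
  (forall x y, p (x + y) <= p x + p y) /\
  (forall a x, p (a *: x) = modulus a * p x).

Definition cont_seminorm E (p : E -> R) : Prop :=
  seminorm p /\ nbhs 0 [set x | p x < 1].

Section Theory.
Context {E : tvsType (Cplx R)} {p : E -> R} (sp : seminorm p).

Lemma seminormD x y : p (x + y) <= p x + p y. Proof. exact: sp.1. Qed.
Lemma seminormZ a x : p (a *: x) = modulus a * p x. Proof. exact: sp.2. Qed.
Lemma seminorm0 : p 0 = 0.
Proof. by rewrite -(scale0r (0 : E)) seminormZ modulus0 mul0r. Qed.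
Lemma seminormN x : p (- x) = p x.
Proof. by rewrite -scaleN1r seminormZ modulusN modulus1 mul1r. Qed.
Lemma seminormB x y : p (x - y) <= p x + p y.
Proof. by rewrite -[p y]seminormN seminormD. Qed.
Lemma seminormBC x y : p (x - y) = p (y - x).
Proof. by rewrite -seminormN opprB. Qed.
Lemma seminorm_ge0 x : 0 <= p x.
Proof. by have := seminormB x x; rewrite subrr seminorm0; lra. Qed.
Lemma seminorm_tri y x z : p (x - z) <= p (x - y) + p (y - z).
Proof. by rewrite -[x - z](subrKA y) seminormD. Qed.
Lemma seminorm_sum (I : Type) (r : seq I) (P : pred I) (F : I -> E) :
  p (\sum_(i <- r | P i) F i) <= \sum_(i <- r | P i) p (F i).
Proof.
elim/big_ind2: _ => //; first by rewrite seminorm0.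
by move=> x1 x2 y1 y2 h1 h2; rewrite (le_trans (seminormD _ _))// lerD.
Qed.
End Theory.

Lemma cont_seminorm_scale E (p : E -> R) (c : R) : 0 < c -> cont_seminorm p ->
  cont_seminorm (fun x => c * p x).
Proof.
move=> c0 [sp p1]; split.
  split=> [x y|a x]; first by rewrite -mulrDr ler_pM2l// seminormD.
  by rewrite (seminormZ sp) mulrCA.
have toC0' : toC c^-1 != 0 by rewrite toC_neq0 ?invr_gt0.
apply: filterS (nbhs0Z toC0' p1) => _ [x /= x1 <-].
by rewrite (seminormZ sp) modulus_toC_ge0 ?invr_ge0 ?ltW// mulVKf ?gt_eqF.
Qed.

Section Gauge.
Context {E : tvsType (Cplx R)} (D : set E) (acD : absolutely_convex D).

Lemma absolutely_convex_scale a x : modulus a <= 1 -> D x -> D (a *: x).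
Proof.
move=> a1 Dx; rewrite -[_ *: _]addr0 -[X in _ + X](scale0r x).
by apply: acD => //; rewrite normr0 addr0 normE -(@toC1 R) toC_le.
Qed.

Lemma gauge_le (c : Cplx R) (t : R) x :
  0 < t -> modulus c <= t -> D x -> gauge D (c *: x) <= t.
Proof.
move=> t0 ct Dx; apply: ge_inf; first by exists 0 => s [/ltW].
split => //; exists ((c / toC t) *: x).
  apply: absolutely_convex_scale => //.
  rewrite modulusM modulusV modulus_toC_gt0//. by rewrite ler_pdivrMr// mul1r.
rewrite scalerA mulrC divfK//; apply/eqP => /(@toC_inj R) t00.
by rewrite t00 ltxx in t0.
Qed.

Lemma gauge_ge0 x : 0 <= gauge D x.
Proof.
rewrite /gauge; set S := (X in inf X).
have [->|/set0P S0] := eqVneq S set0; first by rewrite inf0.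
by apply: (lb_le_inf S0) => s [/ltW].
Qed.

(** The witness is required because the gauge of a vector outside the span of [D],
    an infimum over the empty set, is zero. *)
Lemma gauge_lt x (e : R) : (exists2 t : R, 0 < t & exists2 y, D y & x = toC t *: y) ->
  gauge D x < e -> exists t : R, [/\ 0 < t, t < e & exists2 y, D y & x = toC t *: y].
Proof.
move=> [t t0 [y Dy xy]] xe; have [|s [s0 [z Dz zx]] se] := inf_lt _ xe.
  by exists t; split => //; exists y.
by exists s; split => //; exists z.
Qed.

Lemma gauge_seminorm :
  (forall x, exists2 t : R, 0 < t & exists2 y, D y & x = toC t *: y) ->
  seminorm (gauge D).
Proof.
move=> absorb.
have add x y : gauge D (x + y) <= gauge D x + gauge D y.
  apply/ler_addgt0Pr => e e0.
  have [|s [s0 se [x' Dx xE]]] := gauge_lt (e := gauge D x + e / 2) (absorb x).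
    by rewrite ltrDl divr_gt0.
  have [|t [t0 te [y' Dy yE]]] := gauge_lt (e := gauge D y + e / 2) (absorb y).
    by rewrite ltrDl divr_gt0.
  have st0 : 0 < s + t by apply: addr_gt0.
  apply: (@le_trans _ _ (s + t)); last first. by lra.
  have -> : x + y =
      toC (s + t) *: (toC (s / (s + t)) *: x' + toC (t / (s + t)) *: y').
    by rewrite xE yE scalerDr !scalerA -!toCM !(mulrC (s + t)) !divfK ?gt_eqF.
  apply: gauge_le => //; first by rewrite modulus_toC_gt0.
  apply: acD => //; rewrite !normE !modulus_toC_gt0 ?divr_gt0// -toCD.
  by rewrite -mulrDl mulfV ?gt_eqF.
have scale a x : a != 0 -> gauge D (a *: x) <= modulus a * gauge D x.
  move=> a0; have ma0 := modulus_gt0 a0.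
  rewrite -ler_pdivrMl//; apply/ler_addgt0Pr => e e0.
  have [|s [s0 se [x' Dx xE]]] := gauge_lt (e := gauge D x + e) (absorb x).
    by rewrite ltrDl.
  apply: (@le_trans _ _ s); last exact: ltW.
  rewrite ler_pdivrMl// xE scalerA; apply: gauge_le => //; first exact: mulr_gt0.
  by rewrite modulusM (modulus_toC_ge0 (ltW s0)).
split => // a x; have [->|a0] := eqVneq a 0.
  rewrite scale0r modulus0 mul0r; apply/eqP; rewrite eq_le gauge_ge0 andbT.
  apply/ler_addgt0Pr => e e0; have [_ _ [y Dy _]] := absorb 0.
  by rewrite add0r -(scale0r y) gauge_le// modulus0 (ltW e0).
apply/eqP; rewrite eq_le scale// -ler_pdivlMl ?modulus_gt0//.
by rewrite -{1}[x](scalerK a0) -modulusV scale ?invr_eq0.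
Qed.
End Gauge.

Lemma nbhs_absorbing E (U : set E) : nbhs 0 U ->
  forall x, exists2 t : R, 0 < t & exists2 y, U y & x = toC t *: y.
Proof.
move=> U0 x; have := @scale_continuous _ E (0 : (Cplx R)^o, x) U.
rewrite /= scale0r => /(_ U0)[[A B]] /= [/nbhs_cplxP[e e0 Ae] Bx] sAB.
exists (e / 2)^-1; first by rewrite invr_gt0 divr_gt0.
have e20 : 0 < e / 2 by rewrite divr_gt0.
exists (toC (e / 2) *: x).
  apply: (sAB (toC (e / 2), x)); split => /=; last exact: nbhs_singleton.
  by apply: Ae; rewrite subr0 modulus_toC_gt0//; lra.
by rewrite scalerA -toCM mulVf ?gt_eqF// toC1 scale1r.
Qed.

Lemma convex_set_comb E (A : set E) (k : R) x y : convex_set A ->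
  0 <= k -> k <= 1 -> A x -> A y -> A (toC k *: x + toC (1 - k) *: y).
Proof.
move=> cA k0 k1 Ax Ay.
have k0' : 0 <= toC k by rewrite -toC0 toC_le.
have k1' : toC k <= 1 by rewrite -toC1 toC_le.
have := cA x y (Itv01 k0' k1') (mem_set Ax) (mem_set Ay).
by rewrite inE /conv/= toCB toC1.
Qed.

(** A convex neighbourhood of zero contains an absolutely convex one, namely its
    balanced core, and the gauge of the latter is a continuous seminorm. *)
Lemma nbhs0_seminorm E (U : set E) : nbhs 0 U ->
  exists2 p : E -> R, cont_seminorm p & forall x, p x < 1 -> U x.
Proof.
move=> U0; have [B cB [Bo Bb]] := @locally_convex _ E.
have [V [BV V0] VU] := Bb _ _ U0.
pose W : set E := [set x | forall a, modulus a <= 1 -> V (a *: x)].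
have nV : nbhs 0 V by apply: open_nbhs_nbhs; split => //; exact: Bo.
have cV := cB _ (mem_set BV).
have nW : nbhs 0 W.
  have := @scale_continuous _ E (0 : (Cplx R)^o, 0) V.
  rewrite /= scale0r => /(_ nV)[[S T]] /= [/nbhs_cplxP[e e0 Se] T0] sV.
  have e20 : 0 < e / 2 by rewrite divr_gt0.
  have ne := toC_neq0 e20.
  apply: filterS (nbhs0Z ne T0) => _ [x Tx <-] a a1; rewrite scalerA.
  apply: (sV (_, x)); split => //=; apply: Se; rewrite subr0 modulusM.
  rewrite (modulus_toC_ge0 (ltW e20)) (@le_lt_trans _ _ (1 * (e / 2)))//; last lra.
  by rewrite ler_pM2r.
have acW : absolutely_convex W.
  move=> a b x y ab Wx Wy c c1.
  have {}ab : modulus a + modulus b <= 1.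
    by move: ab; rewrite !normE -toCD -(@toC1 R) toC_le.
  have V00 : V 0 by exact: V0.
  have key (u v : Cplx R) : modulus u + modulus v <= 1 -> V (u *: x + v *: y).
    move=> uv; have [u0|u0] := eqVneq u 0.
      by rewrite u0 scale0r add0r; apply: Wy; move: uv; rewrite u0 modulus0 add0r.
    have mu0 := modulus_gt0 u0.
    have mv0 := modulus_ge0 v.
    have ru : toC (modulus u) != 0.
      exact: toC_neq0.
    have -> : u *: x = toC (modulus u) *: ((u / toC (modulus u)) *: x).
      by rewrite scalerA mulrCA mulfV// mulr1.
    have Vx : V ((u / toC (modulus u)) *: x).
      by apply: Wx; rewrite modulusM modulusV modulus_toC_ge0 ?modulus_ge0// mulfV// gt_eqF.
    (* when [modulus u = 1] the coefficient [v] vanishes and the rescaling of [y]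
       by [1 - modulus u] would divide by zero *)
    have [mu1|mu1] := eqVneq (modulus u) 1.
      have v0 : v = 0 by apply: modulus0_eq0; lra.
      rewrite v0 scale0r -[X in _ + X](scale0r (0 : E)) -(@toC0 R) -[0 : R](subrr 1) -{2}mu1.
      by apply: convex_set_comb => //; lra.
    have ltu1 : modulus u < 1 by rewrite lt_neqAle mu1 /=; lra.
    have {}mu1 : 0 < 1 - modulus u by rewrite subr_gt0.
    have r1u : toC (1 - modulus u) != 0.
      exact: toC_neq0.
    have -> : v *: y = toC (1 - modulus u) *: ((v / toC (1 - modulus u)) *: y).
      by rewrite scalerA mulrCA mulfV// mulr1.
    apply: convex_set_comb => //; try lra.
    apply: Wy; rewrite modulusM modulusV modulus_toC_gt0// ler_pdivrMr//; lra.
  rewrite scalerDr !scalerA; apply: key; rewrite !modulusM -mulrDr.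
  by rewrite -[leRHS]mulr1 ler_pM ?addr_ge0 ?modulus_ge0.
have sW := gauge_seminorm acW (nbhs_absorbing nW).
have gW x : gauge W x < 1 -> W x.
  move=> /(gauge_lt (nbhs_absorbing nW x))[t [t0 t1 [y Wy ->]]].
  by apply: (absolutely_convex_scale acW) => //; rewrite modulus_toC_gt0// ltW.
exists (gauge W); last first.
  by move=> x /gW /(_ 1); rewrite modulus1 lexx scale1r => /(_ isT) /VU.
split => //; have n2 : toC (2^-1 : R) != 0 by rewrite toC_neq0 ?invr_gt0.
apply: filterS (nbhs0Z n2 nW) => _ [x Wx <-] /=.
have h2 : 0 < (2^-1 : R) by rewrite invr_gt0.
apply: (@le_lt_trans _ _ (2^-1 : R)); last by lra.
by apply: (gauge_le acW) => //; rewrite modulus_toC_gt0.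
Qed.

(** Balls of single continuous seminorms form a basis, which reduces the topology
    of [E] to real estimates. *)
Lemma nbhs_tvsP E (x : E) (A : set E) : nbhs x A <->
  exists2 p : E -> R, cont_seminorm p & forall y, p (y - x) < 1 -> A y.
Proof.
split=> [xA|[p [sp p0] pA]].
  have := nbhsB (- x) xA; rewrite addNr => /nbhs0_seminorm[p cp pA].
  exists p => // y /pA[z Az] /eqP.
  by rewrite addrC (inj_eq (addIr _)) => /eqP <-.
by apply: filterS (nbhsT x p0) => _ [v /= pv <-]; apply: pA; rewrite addrC addKr.
Qed.

Lemma cvg_tvsP E (T : Type) (F : set_system T) (FF : Filter F) (g : T -> E) (l : E) :
  g x @[x --> F] --> l <->
  forall p : E -> R, cont_seminorm p -> forall e : R, 0 < e ->
    \forall x \near F, p (g x - l) < e.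
Proof.
split=> [gl p cp e e0|h A /nbhs_tvsP[p cp pA]]; last first.
  by apply: filterS (h p cp 1 ltr01) => x; exact: pA.
have nl : nbhs l [set y | p (y - l) < e].
  apply/nbhs_tvsP; exists (fun x => e^-1 * p x).
    by apply: cont_seminorm_scale; rewrite ?invr_gt0.
  by move=> y; rewrite ltr_pdivrMl// mulr1.
exact: gl _ nl.
Qed.

End Seminorms.

(** * Mean value inequality, compactness of discs, roots of unity *)

Section RealTools.
Context {R : realType}.

(** For every [e > 0] the set [S] of the [s] with [p (g s - g 0) <= (M + e) * s]
    contains its supremum, and a supremum below one could be increased. The
    hypothesis bounds the Lipschitz constant at each point and not a derivative,
    since [p \o g] need not be differentiable. *)
Lemma mean_value_ineq (E : tvsType (Cplx R)) (p : E -> R) (g : R -> E) (M : R) :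
  seminorm p ->
  (forall s, 0 <= s <= 1 -> forall e, 0 < e -> exists2 delta, 0 < delta &
     forall s', 0 <= s' <= 1 -> `|s' - s| < delta ->
       p (g s' - g s) <= (M + e) * `|s' - s|) ->
  p (g 1 - g 0) <= M.
Proof.
move=> sp loc; apply/ler_addgt0Pr => e e0.
pose S := [set s : R | 0 <= s <= 1 /\ p (g s - g 0) <= (M + e) * s].
have S0 : S 0 by split; rewrite ?lexx ?ler01// subrr (seminorm0 sp) mulr0.
have supS : has_sup S by split; [exists 0|exists 1 => s [/andP[]]].
have sup01 : 0 <= sup S <= 1.
  rewrite sup_ubound//=; last exact: supS.2.
  by apply: ge_sup; [exists 0|move=> s [/andP[]]].
have [delta d0 locS] := loc _ sup01 _ e0.
have Ssup : S (sup S).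
  split => //; have [s Ss slt] := sup_adherent d0 supS.
  have [s01 ps] := Ss.
  have sle : s <= sup S by apply: sup_ubound => //; exact: supS.2.
  have := locS _ s01; rewrite distrC ger0_norm ?subr_ge0// => /(_ _).
  rewrite (seminormBC sp) => h.
  have {}h : p (g (sup S) - g s) <= (M + e) * (sup S - s) by apply: h; lra.
  rewrite (le_trans (seminorm_tri sp (g s) _ _))//.
  by rewrite -[in leRHS](subrK s (sup S)) mulrDr lerD.
have [s1|s1] := ltP (sup S) 1; last first.
  have s1' : sup S = 1 by apply/eqP; rewrite eq_le s1; case/andP: sup01 => _ ->.
  by have := Ssup.2; rewrite s1' mulr1.
pose s' := Num.min (sup S + delta / 2) 1.
have ss' : sup S < s' by rewrite lt_min s1 andbT ltrDl divr_gt0.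
have s'd : s' <= sup S + delta / 2 by rewrite ge_min lexx.
have s'1 : s' <= 1 by rewrite ge_min lexx orbT.
have s'01 : 0 <= s' <= 1 by rewrite s'1 andbT; case/andP: sup01 => ? _; lra.
suff : s' <= sup S by lra.
apply: sup_ubound; first exact: supS.2.
split => //; have := locS _ s'01; rewrite ger0_norm; last by lra.
move=> h; have {}h : p (g s' - g (sup S)) <= (M + e) * (s' - sup S) by apply: h; lra.
rewrite (le_trans (seminorm_tri sp (g (sup S)) _ _))//.
by rewrite -[in leRHS](subrK (sup S) s') mulrDr lerD// Ssup.2.
Qed.

Lemma modulus_sq (a : Cplx R) :
  modulus a ^+ 2 = complex.Re a ^+ 2 + complex.Im a ^+ 2.
Proof.
apply: (@toC_inj R); rewrite /toC (add_Re2_Im2 a) normE -[LHS]/(toC _).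
by rewrite expr2 toCM -expr2.
Qed.

Lemma modulus_le_ReIm (a : Cplx R) :
  modulus a <= `|complex.Re a| + `|complex.Im a|.
Proof.
rewrite -(ler_pXn2r (n := 2))// ?nnegrE ?modulus_ge0 ?addr_ge0//.
rewrite modulus_sq sqrrD !real_normK ?num_real//.
by rewrite addrAC lerDl mulrn_wge0// mulr_ge0.
Qed.

Lemma Re_le_modulus (a : Cplx R) : `|complex.Re a| <= modulus a.
Proof.
rewrite -(ler_pXn2r (n := 2))// ?nnegrE ?modulus_ge0//.
by rewrite modulus_sq real_normK ?num_real// lerDl sqr_ge0.
Qed.

Lemma Im_le_modulus (a : Cplx R) : `|complex.Im a| <= modulus a.
Proof.
rewrite -(ler_pXn2r (n := 2))// ?nnegrE ?modulus_ge0//.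
by rewrite modulus_sq real_normK ?num_real// lerDr sqr_ge0.
Qed.

Definition cplx (x y : R) : Cplx R := Complex x y.

(** Compactness of the closed disc, in the form in which it is used: a scale [t]
    that works locally can be chosen uniformly. It is inherited from the square
    [[-r, r] * [-r, r]]. *)
Lemma disc_uniform (r : R) (P : Cplx R -> R -> Prop) :
  (forall z, modulus z <= r -> exists2 delta : R, 0 < delta &
     forall z' t, modulus z' <= r -> modulus (z' - z) < delta -> 0 < t < delta ->
       P z' t) ->
  exists2 delta : R, 0 < delta &
    forall t, 0 < t < delta -> forall z, modulus z <= r -> P z t.
Proof.
move=> loc.
have cK := compact_setX (@segment_compact R (- r) r) (@segment_compact R (- r) r).
have /compact_near_coveringP cov := cK.
pose Q (t : R) (xy : R * R) := modulus (cplx xy.1 xy.2) <= r ->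
  0 < t -> P (cplx xy.1 xy.2) t.
have dcplx (x y x' y' : R) :
    modulus (cplx x y - cplx x' y') <= `|x - x'| + `|y - y'|.
  exact: (@modulus_le_ReIm (cplx x y - cplx x' y')).
have near_cplx (x y d : R) : 0 < d ->
    \forall x' \near (x, y), modulus (cplx x'.1 x'.2 - cplx x y) < d.
  move=> d0; have d20 : 0 < d / 2 by rewrite divr_gt0.
  exists (ball x (d / 2), ball y (d / 2)); first by split; exact: nbhsx_ballx.
  move=> [x' y'] [/=]; rewrite -!ball_normE /= => xx' yy'.
  by apply: (le_lt_trans (dcplx _ _ _ _)); rewrite (distrC x') (distrC y'); lra.
set K := _ `*` _ in cov.
have [d /= d0 dK] : \forall t \near (0 : R)^'+, K `<=` Q t.
  apply: cov => -[x y] _.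
  have [zr|rz] := leP (modulus (cplx x y)) r.
    have [d d0 dP] := loc _ zr.
    exists ([set xy | modulus (cplx xy.1 xy.2 - cplx x y) < d],
            [set t : R | 0 < t < d]).
      split; first exact: near_cplx.
      exists d => //= t; rewrite /ball_ /= sub0r normrN => td t0.
      by rewrite t0 /= -(gtr0_norm t0).
    by move=> [xy t] [/= h1 h2] h3 _; apply: dP.
  have d0 : 0 < modulus (cplx x y) - r by rewrite subr_gt0.
  exists ([set xy | modulus (cplx xy.1 xy.2 - cplx x y) < modulus (cplx x y) - r],
          setT).
    by split; [exact: near_cplx|exact: filterT].
  move=> [[x' y'] t] [/= h _] zr; exfalso.
  have := modulusB (cplx x' y') (cplx x' y' - cplx x y).
  by rewrite opprB addrC subrK; lra.
exists d => // t /andP[t0 td] z zr.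
have := dK t; rewrite /ball_ /= sub0r normrN gtr0_norm// => /(_ td t0).
move=> /(_ (complex.Re z, complex.Im z)).
have zE : cplx (complex.Re z) (complex.Im z) = z by case: z {zr}.
rewrite /Q /= zE; apply => //; split; rewrite /= in_itv /= -ler_norml.
  exact: le_trans (Re_le_modulus _) zr.
exact: le_trans (Im_le_modulus _) zr.
Qed.

(** Successive square roots [y] of nonnegative real part: since [y] has modulus one,
    [y + 1] has modulus at least the square root of two, and by
    [y ^+ 2 - 1 = (y - 1) * (y + 1)] each root at least halves the squared distance
    to one. *)
Lemma small_root_of_m1 (n : nat) :
  exists2 w : Cplx R, w ^+ (2 ^ n) = -1 & modulus (w - 1) ^+ 2 <= 4 / (2 ^ n)%:R.
Proof.
elim: n => [|n [w wn w1]].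
  exists (-1); first by rewrite expn0 expr1.
  rewrite expn0 -opprD modulusN -[1 + 1]/(2%:R) -toC_nat modulus_toC_gt0//.
  by rewrite divr1 -natrX.
have [y yw y0] : exists2 y : Cplx R, y ^+ 2 = w & 0 <= complex.Re y.
  have [h|h] := leP 0 (complex.Re (sqrtC w)).
    by exists (sqrtC w) => //; rewrite sqrtCK.
  exists (- sqrtC w); first by rewrite sqrrN sqrtCK.
  rewrite (_ : complex.Re _ = - complex.Re (sqrtC w)); first by rewrite oppr_ge0 ltW.
  by case: (sqrtC w).
have yn : y ^+ (2 ^ n.+1) = -1 by rewrite expnS exprM yw.
exists y => //.
have my : modulus y = 1.
  apply/eqP; rewrite -(@pexpr_eq1 _ _ (2 ^ n.+1)) ?expn_gt0 ?modulus_ge0//.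
  by rewrite -modulusX yn modulusN modulus1.
have y1 : 2 <= modulus (y + 1) ^+ 2.
  have := modulus_sq y; rewrite my expr1n => yy.
  rewrite modulus_sq; move: yy y0; case: (y) => a b /=; nra.
have : modulus (y - 1) ^+ 2 * modulus (y + 1) ^+ 2 <= 4 / (2 ^ n)%:R.
  by rewrite -exprMn -modulusM -subr_sqr_1 yw.
have := sqr_ge0 (modulus (y - 1)).
have -> : 4 / (2 ^ n.+1)%:R = 4 / (2 ^ n)%:R / 2 :> R.
  by rewrite expnSr natrM invfM mulrA.
have : 0 <= 4 / (2 ^ n)%:R :> R by rewrite divr_ge0.
move: (4 / _) (modulus (y - 1) ^+ 2) (modulus (y + 1) ^+ 2) y1 => q A B.
by nra.
Qed.

(** A [2 ^ n]-th root of [-1] is a primitive root of unity of order [2 ^ n.+1]. *)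
Lemma small_prim_root (e : R) (N0 : nat) : 0 < e -> exists N (w : Cplx R),
  [/\ (N0 < N)%N, N.-primitive_root w & modulus (w - 1) < e].
Proof.
move=> e0; have [n nb nN0] : exists2 n : nat, 4 / e ^+ 2 < n%:R & (N0 <= n)%N.
  exists (Num.bound (4 / e ^+ 2) + N0)%N; last exact: leq_addl.
  apply: (lt_le_trans (archi_boundP (divr_ge0 (ler0n R 4) (sqr_ge0 e)))).
  by rewrite ler_nat leq_addr.
have [w wn w1] := small_root_of_m1 n.
have w2 : w ^+ (2 ^ n.+1) = 1 by rewrite expnS mulnC exprM wn sqrrN expr1n.
exists (2 ^ n.+1)%N, w; split.
- by apply: (leq_ltn_trans (leqW nN0)); exact: ltn_expl.
- have [m mw mN] := prim_order_exists (expn_gt0 2 n.+1) w2.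
  have /(dvdn_pfactor _ _ (isT : prime 2)) [j jn mE] := mN.
  rewrite mE in mw; have [jn'|] := ltnP j n.+1; last first.
    by move=> nj; rewrite (_ : n.+1 = j) //; apply/eqP; rewrite eqn_leq nj jn.
  have : (2 ^ j %| 2 ^ n)%N by rewrite dvdn_exp2l.
  rewrite (prim_order_dvd mw) wn eq_sym.
  by rewrite -subr_eq0 opprK -[1 + 1]/(2%:R) pnatr_eq0.
- rewrite -(ltr_pXn2r (n := 2))// ?nnegrE ?modulus_ge0 ?(ltW e0)//.
  apply: (le_lt_trans w1).
  rewrite ltr_pdivrMr ?ltr0n ?expn_gt0// -ltr_pdivrMl ?exprn_gt0// mulrC.
  apply: (@lt_trans _ _ n%:R); last by rewrite ltr_nat ltn_expl.
  exact: nb.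
Qed.

Lemma sum_geometric_root (F : fieldType) (N : nat) (z : F) :
  z ^+ N = 1 -> z != 1 -> \sum_(k < N) z ^+ k = 0.
Proof.
move=> zN z1; have : (z - 1) * \sum_(k < N) z ^+ k = 0 by rewrite -subrX1 zN subrr.
by move/eqP; rewrite mulf_eq0 subr_eq0 (negPf z1) => /eqP.
Qed.

(** The discrete residue of the Cauchy kernel: in the geometric expansion of each
    term in powers of [x / w ^+ k], only the constants survive the summation over
    the roots of unity. *)
Lemma sum_cauchy_kernel (F : fieldType) (N : nat) (w x : F) :
  N.-primitive_root w -> x ^+ N != 1 ->
  \sum_(k < N) w ^+ k / (w ^+ k - x) = N%:R / (1 - x ^+ N).
Proof.
move=> wN xN; have N0 := prim_order_gt0 wN.
have w0 : w != 0 by rewrite (prim_root_eq0 wN) -lt0n.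
have wk (k : nat) : w ^+ k != 0 by rewrite expf_neq0.
have d0 : 1 - x ^+ N != 0 by rewrite subr_eq0 eq_sym.
have kerE k : w ^+ k / (w ^+ k - x) =
    (\sum_(m < N) x ^+ m * (w ^- m) ^+ k) / (1 - x ^+ N).
  pose y := x / w ^+ k.
  have yN : y ^+ N = x ^+ N.
    by rewrite expr_div_n -exprM mulnC exprM (prim_expr_order wN) expr1n divr1.
  have y1 : 1 - y != 0.
    by rewrite subr_eq0; apply: contra_neq xN => y1; rewrite -yN -y1 expr1n.
  have -> : w ^+ k - x = w ^+ k * (1 - y) by rewrite mulrBr mulr1 mulrCA mulfV// mulr1.
  have hS : (1 - y) * (\sum_(m < N) x ^+ m * (w ^- m) ^+ k) = 1 - x ^+ N.
    transitivity (- ((y - 1) * \sum_(i < N) y ^+ i)); last first.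
      by rewrite -subrX1 yN opprB.
    rewrite -(mulNr (y - 1)) opprB; congr (_ * _).
    by apply: eq_bigr => m _; rewrite /y expr_div_n -!exprVn -!exprM mulnC.
  by rewrite invfM mulrA mulfV// mul1r; apply: (mulfI y1); rewrite mulfV// mulrA hS mulfV.
under eq_bigr do rewrite kerE.
rewrite -mulr_suml; congr (_ / _).
rewrite exchange_big /=; case: N N0 wN {xN d0 kerE} => // N _ wN.
rewrite big_ord_recl /= expr0 invr1.
under eq_bigr do rewrite mul1r expr1n.
rewrite sumr_const card_ord big1 ?addr0// => m _.
rewrite -mulr_sumr sum_geometric_root ?mulr0//.
  by rewrite exprVn -exprM mulnC exprM (prim_expr_order wN) expr1n invr1.
rewrite invr_eq1 -(prim_order_dvd wN) /bump /= add1n.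
by rewrite gtnNdvd// ltnS.
Qed.
End RealTools.

(** * The Cauchy estimate for second divided differences *)

Section CauchyEstimate.
Context {R : realType} {E : tvsType (Cplx R)} (p : E -> R) (sp : seminorm p).
Implicit Types (u v : Cplx R -> E) (h z w : Cplx R) (r e M : R).

(** The average over the roots of unity involves pairs of neighbouring points all
    along a circle, which calls for a modulus of differentiability common to the
    whole disc. *)
Definition unif_diff r u : Prop :=
  exists u' : Cplx R -> E, forall e, 0 < e -> exists2 delta : R, 0 < delta &
    forall z z', modulus z <= r -> modulus z' <= r -> modulus (z' - z) < delta ->
      p (u z' - u z - (z' - z) *: u' z) <= e * modulus (z' - z).

(** For the difference quotient [q h = (u h - u 0) / h] this is the vector with
    [q h - q h' = (h - h') *: second_quot u h h'], so that bounding it makes [q]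
    Lipschitz. *)
Definition second_quot u h h' : E :=
  (h - h')^-1 *: (h^-1 *: (u h - u 0) - h'^-1 *: (u h' - u 0)).

Lemma second_quotB u v h h' : second_quot (fun z => u z - v z) h h' =
  second_quot u h h' - second_quot v h h'.
Proof.
rewrite /second_quot -scalerBr; congr (_ *: _).
have aux (a b c d : E) : a - b - (c - d) = a - c - (b - d).
  by rewrite !opprD !opprK addrACA.
by rewrite [RHS]aux -!scalerBr; congr (_ *: _ - _ *: _); exact: aux.
Qed.

Lemma second_quot_le u h h' e : h != 0 -> h' != 0 -> h != h' -> 
  p (u h) <= e -> p (u h') <= e -> p (u 0) <= e ->
  p (second_quot u h h') <=
    (modulus (h - h'))^-1 * ((modulus h)^-1 * 2 + (modulus h')^-1 * 2) * e.
Proof.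
move=> h0 h'0 hh' uh uh' u0.
rewrite (seminormZ sp) modulusV -mulrA ler_pM2l ?invr_gt0 ?modulus_gt0 ?subr_eq0//.
rewrite (le_trans (seminormB sp _ _))// !(seminormZ sp) !modulusV mulrDl.
have bnd k : p (u k) <= e -> p (u k - u 0) <= 2 * e.
  by move=> uk; rewrite (le_trans (seminormB sp _ _))//; lra.
by rewrite lerD// -mulrA ler_pM2l ?invr_gt0 ?modulus_gt0// bnd.
Qed.

Section Kernel.
Variables (r : R) (r0 : 0 < r) (N : nat) (w : Cplx R) (wN : N.-primitive_root w).

Definition kernel h (k : nat) : Cplx R := toC r * w ^+ k / (toC r * w ^+ k - h).

(** The trapezoidal rule, with nodes the [N]-th roots of unity scaled by [r], for the
    Cauchy integral of [u] at [h]. *)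
Definition cauchy_avg u h : E :=
  (N%:R : Cplx R)^-1 *: \sum_(k < N) kernel h k *: u (toC r * w ^+ k).

Lemma modulus_root k : modulus (w ^+ k) = 1.
Proof.
have N0 := prim_order_gt0 wN.
rewrite modulusX; suff -> : modulus w = 1 by rewrite expr1n.
apply/eqP; rewrite -(@pexpr_eq1 _ _ N) ?modulus_ge0//.
by rewrite -modulusX (prim_expr_order wN) modulus1.
Qed.

Lemma modulus_rroot k : modulus (toC r * w ^+ k) = r.
Proof. by rewrite modulusM modulus_root mulr1 modulus_toC_gt0. Qed.

Lemma kernel_den_neq0 h k : modulus h < r -> toC r * w ^+ k - h != 0.
Proof.
move=> hr; rewrite subr_eq0; apply: contraTneq hr => <-.
by rewrite modulus_rroot ltxx.
Qed.

(** As a function of [h], the kernel [c / (c - h)] has second divided difference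
    [1 / ((c - h) * (c - h'))], and [c - h], [c - h'] have modulus at least [r / 2]. *)
Lemma second_quot_cauchy_avg u h h' M : 
  h != 0 -> h' != 0 -> h != h' -> modulus h <= r / 2 -> modulus h' <= r / 2 ->
  (forall z, modulus z <= r -> p (u z) <= M) ->
  p (second_quot (cauchy_avg u) h h') <= 4 * M / r ^+ 2.
Proof.
move=> h0 h'0 hh' hr h'r uM.
have lt2 : r / 2 < r by rewrite ltr_pdivrMr// ltr_pMr// ltr1n.
have N0 := prim_order_gt0 wN.
have den k : toC r * w ^+ k - h != 0 by apply/kernel_den_neq0/(le_lt_trans hr).
have den' k : toC r * w ^+ k - h' != 0 by apply/kernel_den_neq0/(le_lt_trans h'r).
have rC := toC_neq0 r0.
have nz k : toC r * w ^+ k - 0 != 0 by apply: kernel_den_neq0; rewrite modulus0.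
have -> : second_quot (cauchy_avg u) h h' = (N%:R : Cplx R)^-1 *: \sum_(k < N)
    ((toC r * w ^+ k - h)^-1 * (toC r * w ^+ k - h')^-1) *: u (toC r * w ^+ k).
  have first (y : Cplx R) : y != 0 -> (forall k, toC r * w ^+ k - y != 0) ->
      y^-1 *: (cauchy_avg u y - cauchy_avg u 0) =
      (N%:R : Cplx R)^-1 *: \sum_(k < N) (toC r * w ^+ k - y)^-1 *: u (toC r * w ^+ k).
    move=> y0 deny; rewrite /cauchy_avg -scalerBr -sumrB scalerA mulrC -scalerA.
    congr (_ *: _); rewrite scaler_sumr; apply: eq_bigr => k _.
    rewrite -scalerBl scalerA /kernel; congr (_ *: _).
    move: (deny k) (nz k); rewrite subr0 => c1 c2.
    by rewrite mulfV//; field; rewrite y0 c1.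
  rewrite /second_quot !first// -scalerBr -sumrB scalerA mulrC -scalerA.
  congr (_ *: _); rewrite scaler_sumr; apply: eq_bigr => k _.
  rewrite -scalerBl scalerA; congr (_ *: _).
  have hh'0 : h - h' != 0 by rewrite subr_eq0.
  move: (toC r * w ^+ k) (den k) (den' k) => c c1 c2.
  by field; rewrite c1 c2 hh'0.
rewrite (seminormZ sp) modulusV -toC_nat modulus_toC_ge0// ler_pdivrMl ?ltr0n//.
rewrite (le_trans (seminorm_sum sp _ _ _))//.
apply: (@le_trans _ _ (\sum_(k < N) 4 * M / r ^+ 2)); last first.
  by rewrite sumr_const card_ord -[leLHS]mulr_natl.
apply: ler_sum => k _; rewrite (seminormZ sp) modulusM !modulusV.
have bnd y : modulus y <= r / 2 -> (modulus (toC r * w ^+ k - y))^-1 <= 2 / r.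
  move=> yr; rewrite -invf_div lef_pV2 ?posrE ?divr_gt0//.
    have := modulusD (toC r * w ^+ k - y) y; rewrite subrK modulus_rroot; lra.
  by rewrite modulus_gt0// kernel_den_neq0// (le_lt_trans yr).
have -> : 4 * M / r ^+ 2 = 2 / r * (2 / r) * M by field; rewrite gt_eqF.
rewrite ler_pM ?mulr_ge0 ?invr_ge0 ?modulus_ge0 ?(seminorm_ge0 sp)//.
  by rewrite ler_pM ?invr_ge0 ?modulus_ge0 ?bnd.
by rewrite uM// modulus_rroot.
Qed.
End Kernel.

(** The homotopy [q] contracts the nodes of the circle to the pole [h]. Along it the
    average moves from the value of [u] at [h], up to the discrete residue, to
    [cauchy_avg]; its speed [g'] is a Riemann sum of the derivative over the closed
    polygon of the nodes, small because the increments of [u] between neighbouring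
    nodes telescope to zero. *)
Lemma cauchy_avg_near r u h e : modulus h < r -> 0 < e -> unif_diff r u ->
  exists2 eta : R, 0 < eta & forall N w, N.-primitive_root w ->
    (1 < N)%N -> modulus (w - 1) < eta ->
      p (cauchy_avg r N w u h - (1 - (h / toC r) ^+ N)^-1 *: u h) <= e * r.
Proof.
move=> hr e0 [u' ud]; have r0 := le_lt_trans (modulus_ge0 h) hr.
 have [delta d0 udd] := ud _ e0.
exists (delta / r); first exact: divr_gt0.
move=> N w wN N1 w1; have N0 : (0 < N)%N by exact: ltnW.
have NC : (N%:R : Cplx R) != 0 by rewrite pnatr_eq0 -lt0n.
have rC := toC_neq0 r0.
pose q (s : R) (k : nat) := h + toC s * (toC r * w ^+ k - h).
pose g (s : R) : E := (N%:R : Cplx R)^-1 *: \sum_(k < N) kernel r w h k *: u (q s k).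
pose g' (s : R) : E :=
  (N%:R : Cplx R)^-1 *: \sum_(k < N) (toC r * w ^+ k) *: u' (q s k).
have qr s k : 0 <= s <= 1 -> modulus (q s k) <= r.
  move=> /andP[s0 s1].
  have -> : q s k = toC (1 - s) * h + toC s * (toC r * w ^+ k).
    by rewrite /q toCB toC1; ring.
  rewrite (le_trans (modulusD _ _))// !modulusM (modulus_root wN) !modulus_toC_ge0 ?subr_ge0//; last exact: ltW.
  by nra.
have q1 k : q 1 k = toC r * w ^+ k by rewrite /q toC1; ring.
have q0 k : q 0 k = h by rewrite /q toC0 mul0r addr0.
have -> : cauchy_avg r N w u h = g 1 by rewrite /g; under eq_bigr do rewrite q1.
have -> : (1 - (h / toC r) ^+ N)^-1 *: u h = g 0.
  rewrite /g; under eq_bigr do rewrite q0.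
  rewrite -scaler_suml scalerA; congr (_ *: _).
  rewrite (eq_bigr (fun k : 'I_N => w ^+ k / (w ^+ k - h / toC r))) => [|k _].
    rewrite (sum_cauchy_kernel wN) ?mulVKf ?mulKf//.
    apply: contraTneq hr => hN; rewrite -leNgt.
    have : modulus (h / toC r) = 1.
      apply/eqP; rewrite -(@pexpr_eq1 _ _ N) ?modulus_ge0//.
      by rewrite -modulusX hN modulus1.
    by rewrite modulusM modulusV modulus_toC_gt0// => /divr1_eq ->.
  rewrite /kernel; field; rewrite rC /=; by rewrite mulrC (kernel_den_neq0 r0 wN).
(* the factor [w - 1] of the increments cancels, so only the accuracy [e] remains *)
have g'e s : 0 <= s <= 1 -> p (g' s) <= e * r.
  move=> s01; have [->|sn0] := eqVneq s 0.
    rewrite /g'; under eq_bigr do rewrite q0.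
    rewrite -scaler_suml -mulr_sumr sum_geometric_root.
    - by rewrite mulr0 scale0r scaler0 (seminorm0 sp) mulr_ge0// ltW.
    - exact: prim_expr_order wN.
    - rewrite -[w]expr1 -(prim_order_dvd wN) gtnNdvd//.
  have s0 : 0 < s by rewrite lt0r sn0; case/andP: s01.
  have w10 : w - 1 != 0.
    by rewrite subr_eq0 -[w]expr1 -(prim_order_dvd wN) gtnNdvd.
  have dq k : q s k.+1 - q s k = toC s * (w - 1) * (toC r * w ^+ k).
    by rewrite /q exprS; ring.
  have mdq k : modulus (q s k.+1 - q s k) = s * modulus (w - 1) * r.
    by rewrite dq modulusM (modulus_rroot r0 wN) modulusM modulus_toC_gt0.
  (* the polygon closes up, as [w ^+ N = 1] *)
  have tel : \sum_(k < N) (u (q s k.+1) - u (q s k)) = 0.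
    rewrite -(big_mkord xpredT (fun k => u (q s k.+1) - u (q s k))).
    by rewrite telescope_sumr// /q (prim_expr_order wN) expr0 subrr.
  have key : (toC s * (w - 1) * N%:R) *: g' s =
      - \sum_(k < N) (u (q s k.+1) - u (q s k) - (q s k.+1 - q s k) *: u' (q s k)).
    rewrite [in RHS]sumrB tel sub0r opprK /g' scalerA mulfK// scaler_sumr.
    by apply: eq_bigr => k _; rewrite dq scalerA.
  have : p ((toC s * (w - 1) * N%:R) *: g' s) <= \sum_(k < N) e * (s * modulus (w - 1) * r).
    rewrite key (seminormN sp) (le_trans (seminorm_sum sp _ _ _))//.
    apply: ler_sum => k _; rewrite -(mdq k); apply: udd; rewrite ?qr// mdq.
    have s1 : s <= 1 by case/andP: s01.
    move: w1; rewrite ltr_pdivlMr//; apply: le_lt_trans.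
    by rewrite ler_pM2r// ger_pMl// modulus_gt0.
  rewrite (seminormZ sp) !modulusM modulus_toC_gt0// -toC_nat modulus_toC_ge0//.
  rewrite sumr_const card_ord -[leRHS]mulr_natr.
  have -> : e * (s * modulus (w - 1) * r) * N%:R = s * modulus (w - 1) * N%:R * (e * r) by ring.
  by rewrite ler_pM2l// !mulr_gt0 ?modulus_gt0// ltr0n.
apply: (mean_value_ineq sp) => s s01 e1 e10.
have e1r : 0 < e1 / r by rewrite divr_gt0.
have [delta1 d10 ud1] := ud _ e1r.
exists (delta1 / (2 * r)); first by rewrite divr_gt0// mulr_gt0.
move=> s' s'01 ss'.
have main : p (g s' - g s - toC (s' - s) *: g' s) <= e1 * `|s' - s|.
  have -> : g s' - g s - toC (s' - s) *: g' s = (N%:R : Cplx R)^-1 *: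
      \sum_(k < N) kernel r w h k *: (u (q s' k) - u (q s k) - (q s' k - q s k) *: u' (q s k)).
    rewrite /g /g' scalerA mulrC -scalerA -!scalerBr scaler_sumr -!sumrB.
    congr (_ *: _); apply: eq_bigr => k _.
    rewrite !scalerBr !scalerA; congr (_ - _ - _ *: _).
    have -> : q s' k - q s k = toC (s' - s) * (toC r * w ^+ k - h).
      by rewrite /q toCB; ring.
    by rewrite /kernel [RHS]mulrCA divfK ?(kernel_den_neq0 r0 wN).
  rewrite (seminormZ sp) modulusV -toC_nat modulus_toC_ge0//.
  rewrite ler_pdivrMl ?ltr0n// (le_trans (seminorm_sum sp _ _ _))//.
  apply: (@le_trans _ _ (\sum_(k < N) e1 * `|s' - s|)); last first.
    by rewrite sumr_const card_ord -[leLHS]mulr_natl.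
  apply: ler_sum => k _; rewrite (seminormZ sp).
  have dq : q s' k - q s k = toC (s' - s) * (toC r * w ^+ k - h).
    by rewrite /q toCB; ring.
  have den := kernel_den_neq0 r0 wN k hr.
  have -> : modulus (kernel r w h k) = r / modulus (toC r * w ^+ k - h).
    by rewrite /kernel modulusM (modulus_rroot r0 wN) modulusV.
  rewrite mulrAC ler_pdivrMr ?modulus_gt0// -ler_pdivlMl//.
  have -> : r^-1 * (e1 * `|s' - s| * modulus (toC r * w ^+ k - h)) =
      e1 / r * modulus (q s' k - q s k).
    by rewrite dq modulusM modulus_toC; ring.
  apply: ud1; rewrite ?qr//.
  rewrite dq modulusM modulus_toC.
  have := modulusB (toC r * w ^+ k) h; rewrite (modulus_rroot r0 wN) => h2.
  move: ss'; rewrite ltr_pdivlMr ?mulr_gt0//.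
  apply: le_lt_trans; rewrite ler_wpM2l//; lra.
rewrite -[g s' - g s](subrK (toC (s' - s) *: g' s)) (le_trans (seminormD sp _ _))//.
rewrite (seminormZ sp) modulus_toC mulrDl addrC lerD// mulrC ler_wpM2r//.
exact: g'e.
Qed.

(** By the discrete Cauchy formula [u] is within [e] of its averages at the three
    points [h], [h'] and [0] simultaneously, for one common choice of [N] and [w];
    the second divided difference of the averages is bounded explicitly. *)
Lemma cauchy_estimate r u M h h' : 0 < r -> unif_diff r u ->
  (forall z, modulus z <= r -> p (u z) <= M) ->
  h != 0 -> h' != 0 -> h != h' -> modulus h <= r / 2 -> modulus h' <= r / 2 ->
  p (second_quot u h h') <= 4 * M / r ^+ 2.
Proof.
move=> r0 ud uM h0 h'0 hh' hr h'r; apply/ler_addgt0Pr => e1 e10.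
(* [K] is the constant of [second_quot_le] *)
set K := (modulus (h - h'))^-1 * ((modulus h)^-1 * 2 + (modulus h')^-1 * 2).
have K0 : 0 < K.
  by rewrite mulr_gt0 ?addr_gt0 ?mulr_gt0 ?invr_gt0 ?modulus_gt0 ?subr_eq0.
pose e := e1 / K; have e0 : 0 < e by rewrite divr_gt0.
have M0 : 0 <= M.
  by rewrite (le_trans (seminorm_ge0 sp (u 0)))// uM// modulus0 ltW.
have lt2 : r / 2 < r by rewrite ltr_pdivrMr// ltr_pMr// ltr1n.
have e'0 : 0 < e / (2 * r) by rewrite divr_gt0// mulr_gt0.
have zr : modulus (0 : Cplx R) <= r / 2 by rewrite modulus0 divr_ge0// ltW.
(* half of [e] pays for the homotopy, half for the discrete residue differing
   from one by at most [2 / N] *)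
have near y : modulus y <= r / 2 -> exists2 eta : R, 0 < eta & forall N w,
    N.-primitive_root w -> (Num.bound (4 * M / e) + 1 < N)%N ->
    modulus (w - 1) < eta -> p (cauchy_avg r N w u y - u y) <= e.
  move=> yr; have [|eta eta0 etaP] := cauchy_avg_near (h := y) _ e'0 ud.
    exact: le_lt_trans lt2.
  exists eta => // N w wN NN w1; have N0 := prim_order_gt0 wN.
  rewrite (le_trans (seminorm_tri sp ((1 - (y / toC r) ^+ N)^-1 *: u y) _ _))//.
  have -> : e = e / (2 * r) * r + e / 2.
    by field; rewrite gt_eqF.
  rewrite lerD//.
    by apply: etaP => //; apply: leq_ltn_trans NN; exact: leq_addl.
  set x := y / toC r.
  have x2 : modulus x <= 2^-1.
    by rewrite modulusM modulusV modulus_toC_gt0// ler_pdivrMr// mulrC.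
  have xN : modulus (x ^+ N) <= N%:R^-1.
    rewrite modulusX (le_trans (lerXn2r N _ _ x2)) ?nnegrE ?modulus_ge0 ?invr_ge0//.
    by rewrite exprVn lef_pV2 ?posrE ?exprn_gt0 ?ltr0n// -natrX ler_nat ltnW// ltn_expl.
  have N2 : (N%:R)^-1 <= 2^-1 :> R.
    rewrite lef_pV2 ?posrE ?ltr0n// ler_nat.
    by apply: leq_ltn_trans NN; exact: leq_addl.
  have x1 : 2^-1 <= modulus (1 - x ^+ N).
    by have := modulusD (1 - x ^+ N) (x ^+ N); rewrite subrK modulus1; lra.
  have xn0 : 1 - x ^+ N != 0.
    by apply/eqP => xn0; move: x1; rewrite xn0 modulus0 invr_le0 leNgt ltr0n.
  have -> : (1 - x ^+ N)^-1 *: u y - u y = (x ^+ N / (1 - x ^+ N)) *: u y.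
    by rewrite -{2}[u y]scale1r -scalerBl; congr (_ *: _); field.
  rewrite (seminormZ sp) modulusM modulusV.
  apply: (@le_trans _ _ (N%:R^-1 * 2 * M)).
    rewrite ler_pM ?mulr_ge0 ?invr_ge0 ?modulus_ge0 ?(seminorm_ge0 sp)//; last first.
      by rewrite uM// (le_trans yr)// ltW.
    rewrite ler_pM ?invr_ge0 ?modulus_ge0// -[leRHS]invrK lef_pV2 ?posrE ?invr_gt0//.
    by rewrite modulus_gt0.
  rewrite -mulrA ler_pdivrMl ?ltr0n//.
  have h1 : 4 * M / e <= N%:R.
    have q0 : 0 <= 4 * M / e by rewrite divr_ge0 ?(ltW e0)// mulr_ge0.
    rewrite (le_trans (ltW (archi_boundP q0)))// ler_nat.
    by rewrite (leq_trans _ (ltnW NN))// leq_addr.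
  by move: h1; rewrite ler_pdivrMr//; lra.
have [eta eta0 nh] := near _ hr; have [eta' eta'0 nh'] := near _ h'r.
have [eta2 eta20 n0] := near _ zr.
pose eta3 := Num.min eta (Num.min eta' eta2).
have eta30 : 0 < eta3 by rewrite !lt_min eta0 eta'0.
have [N [w [NN wN]]] := small_prim_root (Num.bound (4 * M / e) + 1) eta30.
rewrite !lt_min => /and3P[w1 w2 w3].
rewrite -(subrK (second_quot (cauchy_avg r N w u) h h') (second_quot u h h')).
rewrite (le_trans (seminormD sp _ _))// addrC lerD//.
  exact: second_quot_cauchy_avg.
rewrite -second_quotB (le_trans (second_quot_le (e := e) _ _ _ _ _ _))//.
- by rewrite (seminormBC sp) nh.
- by rewrite (seminormBC sp) nh'.
- by rewrite (seminormBC sp) n0.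
- by rewrite -/K /e mulrC divfK// gt_eqF.
Qed.

(** The bound does not involve the derivative of [u], so it passes to limits that are
    uniform on the disc. *)
Lemma cauchy_estimate_limit r u M h h' : 0 < r ->
  (forall e, 0 < e -> exists2 v, unif_diff r v &
     forall z, modulus z <= r -> p (u z - v z) <= e) ->
  (forall z, modulus z <= r -> p (u z) <= M) ->
  h != 0 -> h' != 0 -> h != h' -> modulus h <= r / 2 -> modulus h' <= r / 2 ->
  p (second_quot u h h') <= 4 * M / r ^+ 2.
Proof.
move=> r0 app uM h0 h'0 hh' hr h'r; apply/ler_addgt0Pr => e1 e10.
set K := (modulus (h - h'))^-1 * ((modulus h)^-1 * 2 + (modulus h')^-1 * 2).
have K0 : 0 < K.
  by rewrite mulr_gt0 ?addr_gt0 ?mulr_gt0 ?invr_gt0 ?modulus_gt0 ?subr_eq0.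
pose L := 4 / r ^+ 2 + K.
have L0 : 0 < L by rewrite addr_gt0 ?divr_gt0 ?exprn_gt0.
have [v vd uv] := app _ (divr_gt0 e10 L0).
have lt2 : r / 2 < r by rewrite ltr_pdivrMr// ltr_pMr// ltr1n.
have vM z : modulus z <= r -> p (v z) <= M + e1 / L.
  move=> zr; have := seminormB sp (u z) (u z - v z).
  by rewrite opprB addrC subrK; have := uv z zr; have := uM z zr; lra.
have est := cauchy_estimate r0 vd vM h0 h'0 hh' hr h'r.
rewrite -(subrK (second_quot v h h') (second_quot u h h')).
rewrite (le_trans (seminormD sp _ _))// -second_quotB.
have uvq : p (second_quot (fun z => u z - v z) h h') <= K * (e1 / L).
  by apply: second_quot_le => //; apply: uv; rewrite ?modulus0 ?(ltW r0)// (le_trans _ (ltW lt2)).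
apply: (le_trans (lerD uvq est)).
have -> : K * (e1 / L) + 4 * (M + e1 / L) / r ^+ 2 = 4 * M / r ^+ 2 + L * (e1 / L).
  by rewrite /L; ring.
by rewrite mulrCA mulfV ?mulr1// gt_eqF.
Qed.
End CauchyEstimate.

(** * Continuously differentiable functions of several variables *)

Section Limits.
Context {R : realType}.
Implicit Types E : tvsType (Cplx R).

Lemma subrACA (V : zmodType) (a b c d : V) : a - b - (c - d) = a - c - (b - d).
Proof. by rewrite !opprD !opprK addrACA. Qed.

Lemma cvg_dnbhs0P E (g : Cplx R -> E) (l : E) :
  g h @[h --> (0 : Cplx R)^'] --> l <->
  forall p : E -> R, cont_seminorm p -> forall e : R, 0 < e ->
    exists2 delta : R, 0 < delta &
      forall h, h != 0 -> modulus h < delta -> p (g h - l) < e.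
Proof.
split=> [/cvg_tvsP gl p cp e e0|gl].
  have /nbhs_cplxP[delta d0 dP] := gl p cp e e0.
  by exists delta => // h h0 hd; apply: dP => //; rewrite subr0.
apply/cvg_tvsP => p cp e e0; have [delta d0 dP] := gl p cp e e0.
apply/nbhs_cplxP; exists delta => // h; rewrite subr0 => hd h0.
exact: dP.
Qed.

Lemma cvg_rvP E d (f : 'rV[Cplx R]_d -> E) (z : 'rV[Cplx R]_d) :
  {for z, continuous f} <->
  forall p : E -> R, cont_seminorm p -> forall e : R, 0 < e ->
    exists2 delta : R, 0 < delta &
      forall w : 'rV[Cplx R]_d, (forall k, modulus (w 0 k - z 0 k) < delta) ->
        p (f w - f z) < e.
Proof.
have eqv := cvg_tvsP (nbhs_filter z) f (f z); split=> [/eqv fz p cp e e0|fz].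
  by have /nbhs_rvP := fz p cp e e0.
by apply/eqv => p cp e e0; apply/nbhs_rvP; exact: fz.
Qed.

Lemma common_radius d (P : 'I_d -> R -> Prop) :
  (forall j a b, 0 < b -> b <= a -> P j a -> P j b) ->
  (forall j, exists2 a : R, 0 < a & P j a) ->
  exists2 a : R, 0 < a & forall j, P j a.
Proof.
move=> Pdown /(_ _)/cid2 -/all_sig2[rho rho0 Prho].
exists (\big[Num.min/1]_(j < d) rho j); first by apply/lt_bigmin.
move=> j; apply: Pdown (Prho j); first by apply/lt_bigmin.
exact: bigmin_le_cond.
Qed.

Lemma unif_diff_comb E (p : E -> R) (sp : seminorm p) (r : R) (a : Cplx R)
    (u v : Cplx R -> E) :
  unif_diff p r u -> unif_diff p r v -> unif_diff p r (fun z => a *: (u z - v z)).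
Proof.
move=> [u' ud] [v' vd]; exists (fun z => a *: (u' z - v' z)) => e e0.
have a0 : 0 < 2 * (modulus a + 1) by have := modulus_ge0 a; lra.
have [du du0 ude] := ud _ (divr_gt0 e0 a0).
have [dv dv0 vde] := vd _ (divr_gt0 e0 a0).
exists (Num.min du dv) => [|z z' zr z'r]; first by rewrite lt_min du0.
rewrite lt_min => /andP[zu zv].
have -> : a *: (u z' - v z') - a *: (u z - v z) - (z' - z) *: (a *: (u' z - v' z)) =
   a *: ((u z' - u z - (z' - z) *: u' z) - (v z' - v z - (z' - z) *: v' z)).
  rewrite [(z' - z) *: (a *: _)]scalerA mulrC -scalerA -!scalerBr; congr (_ *: _).
  by rewrite scalerBr (subrACA (u z')) [LHS]subrACA.
rewrite (seminormZ sp); have := ude z z' zr z'r zu; have := vde z z' zr z'r zv.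
have := seminormB sp (u z' - u z - (z' - z) *: u' z) (v z' - v z - (z' - z) *: v' z).
move: (p _) (p _) (p _) => A B C ABC Ch Bh.
set m := modulus (z' - z) in Ch Bh *.
have m0 : 0 <= m := modulus_ge0 _; have ma := modulus_ge0 a.
apply: (@le_trans _ _ (modulus a * (2 * (e / (2 * (modulus a + 1)) * m)))).
  by rewrite ler_wpM2l//; lra.
have -> : modulus a * (2 * (e / (2 * (modulus a + 1)) * m)) =
    modulus a / (modulus a + 1) * (e * m).
  by field; lra.
by rewrite ler_piMl ?mulr_ge0 ?(ltW e0)// ler_pdivrMr; lra.
Qed.

End Limits.

Local Notation line z k x := (z + x *: delta_mx 0 k).

Section SeveralVariables.
Context {R : realType} {d : nat}.
Implicit Types (E : tvsType (Cplx R)) (Omega : set 'rV[Cplx R]_d).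
Implicit Types (z w : 'rV[Cplx R]_d) (j k : 'I_d) (t h x : Cplx R) (r rho e M : R).

Definition polyball z rho : set 'rV[Cplx R]_d :=
  [set w | forall k, modulus (w 0 k - z 0 k) < rho].

Lemma lineE z k x j : (line z k x) 0 j = z 0 j + x *+ (j == k).
Proof. by rewrite !mxE eqxx /= mulr_natr. Qed.

Lemma line0 z k : line z k 0 = z.
Proof. by rewrite scale0r addr0. Qed.

Lemma lineD z k x t : line (line z k x) k t = line z k (x + t).
Proof. by rewrite -addrA -scalerDl. Qed.

Lemma lineC z k j x t : line (line z k x) j t = line (line z j t) k x.
Proof. by rewrite addrAC. Qed.

Lemma modulus_mulrb x (b : bool) : modulus (x *+ b) <= modulus x.
Proof. by case: b; rewrite ?mulr1n// mulr0n modulus0 modulus_ge0. Qed.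

Lemma polyball_line z w k x rho rho' : polyball z rho w -> modulus x < rho' ->
  polyball z (rho + rho') (line w k x).
Proof.
move=> zw xr j; rewrite lineE addrAC (le_lt_trans (modulusD _ _))//.
by rewrite ltrD// (le_lt_trans (modulus_mulrb _ _)).
Qed.

Lemma polyball_center z rho : 0 < rho -> polyball z rho z.
Proof. by move=> r0 k; rewrite subrr modulus0. Qed.

Lemma polyball_le z rho rho' : rho <= rho' -> polyball z rho `<=` polyball z rho'.
Proof. by move=> rr w zw k; exact: lt_le_trans rr. Qed.

Lemma polyball_segment z w k x (s : R) rho : 0 <= s <= 1 ->
  polyball z rho w -> polyball z rho (line w k x) ->
  polyball z rho (line w k (toC s * x)).
Proof.
move=> /andP[s0 s1] zw zwx j; rewrite lineE.
have := zwx j; rewrite lineE => wx.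
have -> : w 0 j + (toC s * x) *+ (j == k) - z 0 j =
    toC (1 - s) * (w 0 j - z 0 j) + toC s * (w 0 j + x *+ (j == k) - z 0 j).
  by rewrite -mulrnAr toCB toC1; ring.
rewrite (le_lt_trans (modulusD _ _))// !modulusM !modulus_toC_ge0 ?subr_ge0//.
move: (zw j) wx; move: (modulus _) (modulus _) => a b arho brho.
have [->|sn0] := eqVneq s 0; first by lra.
have s_gt0 : 0 < s by rewrite lt0r sn0.
by nra.
Qed.

Lemma open_polyball Omega z : open Omega -> Omega z ->
  exists2 rho : R, 0 < rho & polyball z rho `<=` Omega.
Proof. by move=> oO Oz; apply/nbhs_rvP; exact: open_nbhs_nbhs. Qed.

(** The partial derivatives are a parameter, not [partial], because for a function
    seen in the completion they are first known as values of the total derivative. *)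
Definition has_C1 E Omega (f : 'rV[Cplx R]_d -> E) (g : 'I_d -> 'rV[Cplx R]_d -> E) :=
  forall z, Omega z -> forall j,
    partial_quot j f z h @[h --> (0 : Cplx R)^'] --> g j z /\
    {for z, continuous (g j)}.

(** Continuity of the partial derivative makes it strict: by the mean value
    inequality on the segment from [w], the error is controlled by the oscillation
    of [g j] near [z0]. *)
Lemma strict_partial E (p : E -> R) Omega f g z0 j e : cont_seminorm p ->
  open Omega -> has_C1 Omega f g -> Omega z0 -> 0 < e ->
  exists2 rho, 0 < rho & forall w t,
    polyball z0 rho w -> polyball z0 rho (line w j t) ->
    p (f (line w j t) - f w - t *: g j z0) <= e * modulus t.
Proof.
move=> cp oO fg Oz0 e0; have sp := cp.1.
have [rho1 rho10 rhoO] := open_polyball oO Oz0.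
have [rho2 rho20 rhog] := (cvg_rvP _ _).1 (fg _ Oz0 j).2 p cp e e0.
exists (Num.min rho1 rho2) => [|w t zw zwt]; first by rewrite lt_min rho10.
pose y (s : R) := line w j (toC s * t).
have ys s : 0 <= s <= 1 -> polyball z0 (Num.min rho1 rho2) (y s).
  by move=> s01; exact: polyball_segment.
pose gam (s : R) := f (y s) - (toC s * t) *: g j z0.
have -> : f (line w j t) - f w - t *: g j z0 = gam 1 - gam 0.
  rewrite /gam /y toC1 mul1r toC0 mul0r line0 scale0r subr0.
  by rewrite addrAC.
apply: (mean_value_ineq sp) => s s01 e1 e10.
have Oy : Omega (y s).
  by apply: rhoO; apply: polyball_le (ys s s01); rewrite ge_min lexx.
have gy : p (g j (y s) - g j z0) < e.
  by apply: rhog => k; have := ys s s01 k; rewrite lt_min => /andP[].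
have t1 : 0 < modulus t + 1 by have := modulus_ge0 t; lra.
have [del del0 delP] :=
  (cvg_dnbhs0P _ _).1 (fg _ Oy j).1 p cp (e1 / (modulus t + 1)) (divr_gt0 e10 t1).
exists (del / (modulus t + 1)); first exact: divr_gt0.
move=> s' s'01 ss'; pose h := toC (s' - s) * t.
have mh : modulus h = `|s' - s| * modulus t by rewrite modulusM modulus_toC.
have [h0|hn0] := eqVneq h 0.
  have hE : toC s' * t = toC s * t.
    by apply/eqP; rewrite -subr_eq0 -mulrBl -toCB -/h h0.
  rewrite /gam /y hE subrr (seminorm0 sp) mulr_ge0// addr_ge0 ?(ltW e10)//.
  by rewrite mulr_ge0 ?modulus_ge0 ?ltW.
have yh : y s' = line (y s) j h.
  by rewrite /y lineD /h toCB; congr (_ + _ *: _); ring.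
have gamE : gam s' - gam s =
    h *: (partial_quot j f (y s) h - g j (y s)) + h *: (g j (y s) - g j z0).
  rewrite -scalerDr subrKA scalerBr /partial_quot scalerA mulfV// scale1r -yh.
  by rewrite /gam subrACA -scalerBl /h toCB mulrBl.
rewrite gamE (le_trans (seminormD sp _ _))// !(seminormZ sp).
have hdel : modulus h < del.
  rewrite mh; move: ss'; rewrite ltr_pdivlMr//; apply: le_lt_trans.
  by rewrite ler_wpM2l//; lra.
have := delP h hn0 hdel; move: gy.
rewrite mh; move: (p (_ - g j (y s))) (p (_ - g j z0)) => A B Be.
rewrite ltr_pdivlMr// => Ae.
have m0 := modulus_ge0 t.
have key : modulus t * A + modulus t * B <= e * modulus t + e1.
  have A0 : modulus t * A <= e1; last by nra.
  have [An|Ap] := ltP A 0; first by rewrite (@le_trans _ _ 0) ?(ltW e10)// mulr_ge0_le0// ltW.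
  by nra.
by rewrite -!mulrA -mulrDr mulrC ler_wpM2r.
Qed.

(** Strict differentiability at the points of a compact disc. *)
Lemma unif_diff_line E (p : E -> R) Omega f g z k r : cont_seminorm p ->
  open Omega -> has_C1 Omega f g ->
  (forall x, modulus x <= r -> Omega (line z k x)) ->
  unif_diff p r (fun x => f (line z k x)).
Proof.
move=> cp oO fg dO; have sp := cp.1.
exists (fun x => g k (line z k x)) => e e0.
have e20 : 0 < e / 2 by rewrite divr_gt0.
have [|delta d0 dP] := @disc_uniform R r (fun x (t : R) => forall x', modulus x' <= r ->
    modulus (x' - x) < t ->
    p (f (line z k x') - f (line z k x) - (x' - x) *: g k (line z k x)) <=
      e * modulus (x' - x)).
  move=> x0 x0r; have Ox := dO _ x0r.
  have [rho rho0 rhoP] := strict_partial k cp oO fg Ox e20.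
  have [rho' rho'0 rhog] := (cvg_rvP _ _).1 (fg _ Ox k).2 p cp _ e20.
  pose r0 := Num.min rho rho'.
  have r00 : 0 < r0 by rewrite lt_min rho0.
  have near_x y : modulus (y - x0) < r0 -> polyball (line z k x0) r0 (line z k y).
    move=> yx j; rewrite !lineE opprD addrACA subrr add0r -mulrnBl.
    exact: le_lt_trans (modulus_mulrb _ _) yx.
  exists (r0 / 2); first by rewrite divr_gt0.
  move=> x t xr xx0 /andP[t0 tr] x' x'r x'x.
  have bx : polyball (line z k x0) r0 (line z k x) by apply: near_x; lra.
  have bx' : polyball (line z k x0) r0 (line z k x').
    by apply: near_x; have := modulusD (x' - x) (x - x0); rewrite subrKA; lra.
  have sP : p (f (line z k x') - f (line z k x) - (x' - x) *: g k (line z k x0)) <=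
      e / 2 * modulus (x' - x).
    have xx' : line z k x' = line (line z k x) k (x' - x) by rewrite lineD subrKC.
    have := rhoP (line z k x) (x' - x); rewrite -xx'; apply.
      by apply: polyball_le bx; rewrite ge_min lexx.
    by apply: polyball_le bx'; rewrite ge_min lexx.
  have gP : p (g k (line z k x) - g k (line z k x0)) < e / 2.
    by apply: rhog => j; have := bx j; rewrite lt_min => /andP[].
  rewrite -(subrKA ((x' - x) *: g k (line z k x0))) -scalerBr.
  rewrite (le_trans (seminormD sp _ _))// (seminormZ sp) (seminormBC sp (g k _)).
  by have := modulus_ge0 (x' - x); nra.
exists (delta / 2) => [|x x' xr x'r xx']; first by rewrite divr_gt0.
by apply: (dP (delta / 2)) => //; rewrite divr_gt0//=; lra.
Qed.

(** Reading [t^-1] as a bound turns boundedness on the disc into the existence of a scale *)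
Lemma bounded_line E (p : E -> R) Omega (f : 'rV[Cplx R]_d -> E) z k r :
  cont_seminorm p -> (forall w, Omega w -> {for w, continuous f}) ->
  (forall x, modulus x <= r -> Omega (line z k x)) ->
  exists M, forall x, modulus x <= r -> p (f (line z k x)) <= M.
Proof.
move=> cp fc dO; have sp := cp.1.
have [|delta d0 dP] := @disc_uniform R r (fun x (t : R) => p (f (line z k x)) <= t^-1).
  move=> x0 x0r; have [rho rho0 rhoP] := (cvg_rvP _ _).1 (fc _ (dO _ x0r)) p cp _ ltr01.
  set A := p (f (line z k x0)) + 1.
  have A0 : 0 < A by rewrite ltr_wpDl// (seminorm_ge0 sp).
  exists (Num.min rho A^-1); first by rewrite lt_min rho0 invr_gt0.
  move=> x t xr; rewrite !lt_min => /andP[xrho _] /andP[t0 /andP[_ tA]].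
  apply: (@le_trans _ _ A); last first.
    by rewrite -[A]invrK lef_pV2 ?posrE ?invr_gt0// ltW.
  have := seminormD sp (f (line z k x) - f (line z k x0)) (f (line z k x0)).
  rewrite subrK => h; have : p (f (line z k x) - f (line z k x0)) < 1.
    apply: rhoP => j; rewrite !lineE opprD addrACA subrr add0r -mulrnBl.
    exact: le_lt_trans (modulus_mulrb _ _) xrho.
  rewrite /A; lra.
exists (delta / 2)^-1 => x xr; apply: dP => //; rewrite divr_gt0//=; lra.
Qed.

(** A first partial derivative inherits the Cauchy estimate along every axis,
    being the limit, uniform on discs, of difference quotients of [f]. *)
Lemma cauchy_estimate_partial E (p : E -> R) Omega f g z j k r M h h' :
  cont_seminorm p -> open Omega -> has_C1 Omega f g -> 0 < r ->
  (forall x, modulus x <= r -> Omega (line z k x)) ->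
  (forall x, modulus x <= r -> p (g j (line z k x)) <= M) ->
  h != 0 -> h' != 0 -> h != h' -> modulus h <= r / 2 -> modulus h' <= r / 2 ->
  p (second_quot (fun x => g j (line z k x)) h h') <= 4 * M / r ^+ 2.
Proof.
move=> cp oO fg r0 dO gM; have sp := cp.1.
apply: (cauchy_estimate_limit sp) => // e e0.
have e20 : 0 < e / 2 by rewrite divr_gt0.
have [|delta d0 dP] := @disc_uniform R r (fun x (t : R) =>
    Omega (line (line z k x) j (toC t)) /\
    p (g j (line z k x) - partial_quot j f (line z k x) (toC t)) <= e).
  move=> x0 x0r; have Ox := dO _ x0r.
  have [rho rho0 rhoP] := strict_partial j cp oO fg Ox e20.
  have [rho' rho'0 rhog] := (cvg_rvP _ _).1 (fg _ Ox j).2 p cp _ e20.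
  have [rho2 rho20 rhoO] := open_polyball oO Ox.
  pose r1 := Num.min rho (Num.min rho' rho2).
  have r10 : 0 < r1 by rewrite !lt_min rho0 rho'0.
  have r11 : r1 <= rho by rewrite ge_min lexx.
  have r12 : r1 <= rho' by rewrite !ge_min lexx orbT.
  have r13 : r1 <= rho2 by rewrite !ge_min lexx !orbT.
  exists (r1 / 2); first by rewrite divr_gt0.
  move=> x t xr xx0 /andP[t0 tr].
  have bx : polyball (line z k x0) (r1 / 2) (line z k x).
    move=> i; rewrite !lineE opprD addrACA subrr add0r -mulrnBl.
    exact: le_lt_trans (modulus_mulrb _ _) xx0.
  have bxt : polyball (line z k x0) r1 (line (line z k x) j (toC t)).
    rewrite [r1](splitr r1); apply: polyball_line => //.
    by rewrite modulus_toC_gt0.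
  have {}bx : polyball (line z k x0) r1 (line z k x).
    by apply: polyball_le bx; lra.
  split; first by apply: rhoO; exact: polyball_le bxt.
  have gP : p (g j (line z k x) - g j (line z k x0)) < e / 2.
    by apply: rhog => i; exact: lt_le_trans r12.
  rewrite (le_trans (seminorm_tri sp (g j (line z k x0)) _ _))//.
  rewrite [leRHS](splitr e) lerD ?(ltW gP)// (seminormBC sp).
  have t00 := toC_neq0 t0.
  have -> : partial_quot j f (line z k x) (toC t) - g j (line z k x0) =
     (toC t)^-1 *: (f (line (line z k x) j (toC t)) - f (line z k x) -
        toC t *: g j (line z k x0)).
    by rewrite [RHS]scalerBr scalerA mulVf// scale1r.
  rewrite (seminormZ sp) modulusV modulus_toC_gt0// ler_pdivrMl//.
  have := rhoP _ _ (polyball_le r11 bx) (polyball_le r11 bxt).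
  by rewrite modulus_toC_gt0// (mulrC _ t).
pose t := delta / 2; have td : 0 < t < delta by rewrite divr_gt0//=; rewrite /t; lra.
exists (fun x => partial_quot j f (line z k x) (toC t)); last first.
  by move=> x xr; have [] := dP t td x xr.
have ud1 := unif_diff_line cp oO fg dO.
have shift : (fun x => f (line (line z k x) j (toC t))) =
    (fun x => f (line (line z j (toC t)) k x)).
  by apply/funext => x; rewrite lineC.
have ud2 : unif_diff p r (fun x => f (line (line z k x) j (toC t))).
  rewrite shift; apply: (unif_diff_line cp oO fg) => x xr.
  by rewrite lineC; have [] := dP t td x xr.
exact: unif_diff_comb sp _ _ _ _ ud2 ud1.
Qed.

End SeveralVariables.

(** * Local completeness and difference quotients *)

Section LocalCompleteness.
Context {R : realType}.
Implicit Types (E : tvsType (Cplx R)) (c h : Cplx R).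

Lemma nbhs_seminorm_ball E (p : E -> R) (x : E) (e : R) : cont_seminorm p -> 0 < e ->
  nbhs x [set y | p (y - x) < e].
Proof.
move=> cp e0; apply/nbhs_tvsP; exists (fun x => e^-1 * p x).
  by apply: cont_seminorm_scale; rewrite ?invr_gt0.
by move=> y; rewrite ltr_pdivrMl// mulr1.
Qed.

Lemma disk_spanZ E (D : set E) c x : absolutely_convex D -> D x ->
  disk_span D (c *: x).
Proof.
move=> acD Dx; pose n := (Num.bound (modulus c)).+1.
exists n => //=; exists ((c / n%:R) *: x); last first.
  by rewrite scalerA mulrC divfK// pnatr_eq0.
apply: (absolutely_convex_scale acD) => //.
rewrite modulusM modulusV -toC_nat modulus_toC_ge0// ler_pdivrMr ?ltr0n// mul1r.
rewrite (le_trans (ltW (archi_boundP (modulus_ge0 c))))// ler_nat; exact: leqnSn.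
Qed.

Lemma disk_span_sub_scale E (D : set E) x y : absolutely_convex D ->
  disk_span D x -> disk_span D y ->
  exists2 t : R, 0 < t & exists2 v, D v & x - y = toC t *: v.
Proof.
move=> acD [m _ [x' Dx' <-]] [n _ [y' Dy' <-]].
pose t : R := (m + n).+1%:R; have t0 : 0 < t by rewrite ltr0n.
exists t => //; exists ((m%:R / toC t) *: x' + (- (n%:R / toC t)) *: y').
  apply: acD => //; rewrite !normE -toCD -toC1 toC_le modulusN !modulusM !modulusV.
  rewrite -!toC_nat !modulus_toC_ge0 ?(ltW t0)// -mulrDl ler_pdivrMr// mul1r.
  by rewrite -natrD ler_nat leqnSn.
rewrite scalerDr !scalerA mulrN !(mulrC (toC t)) !divfK ?toC_neq0//.
by rewrite scaleNr.
Qed.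

Definition admissible (r : R) h h' : Prop :=
  [/\ h != 0, h' != 0, h != h', modulus h <= r / 2 & modulus h' <= r / 2].

(** The second divided differences lie in a closed disk [D], the intersection of all
    closed seminorm balls containing them; so the difference quotients are Lipschitz
    for the norm of the Banach space spanned by [D]. The limit is independent of the
    seminorm, and each seminorm has its own rate. *)
Lemma locally_complete_diff_quot E (u : Cplx R -> E) (r : R) :
  locally_complete E -> 0 < r ->
  (forall p : E -> R, cont_seminorm p ->
     exists M, forall h h', admissible r h h' -> p (second_quot u h h') <= M) ->
  exists l : E, forall p : E -> R, cont_seminorm p -> forall M,
    (forall h h', admissible r h h' -> p (second_quot u h h') <= M) ->
    forall h, h != 0 -> modulus h <= r / 2 ->
      p (h^-1 *: (u h - u 0) - l) <= M * modulus h.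
Proof.
move=> lcE r0 bnd; pose bounds (p : E -> R) M :=
  forall h h', admissible r h h' -> p (second_quot u h h') <= M.
have r2 : 0 < r / 2 by rewrite divr_gt0.
(* [r / 2] and [r / 4] witness that the set of differences is nonempty *)
have bounds_ge0 p M : cont_seminorm p -> bounds p M -> 0 <= M.
  move=> [sp _] bM; apply: le_trans (bM (toC (r / 2)) (toC (r / 4)) _).
    exact: seminorm_ge0.
  have r4 : 0 < r / 4 by rewrite divr_gt0.
  split; rewrite ?toC_neq0 ?modulus_toC_gt0//; last by lra.
  by apply/eqP => /(@toC_inj R); lra.
pose D : set E := [set x | forall p, cont_seminorm p -> forall M, bounds p M -> p x <= M].
have D0 : D 0.
  by move=> p cp M bM; rewrite (seminorm0 cp.1); exact: bounds_ge0 bM.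
have acD : absolutely_convex D.
  move=> a b x y ab Dx Dy p cp M bM; have sp := cp.1.
  rewrite (le_trans (seminormD sp _ _))// !(seminormZ sp).
  have {}ab : modulus a + modulus b <= 1.
    by move: ab; rewrite !normE -toCD -(@toC1 R) toC_le.
  have := Dx p cp M bM; have := Dy p cp M bM; have := bounds_ge0 p M cp bM.
  have := modulus_ge0 a; have := modulus_ge0 b.
  move: (p x) (p y) (modulus a) (modulus b) ab => A B s t st t0 s0 M0 BM AM.
  by nra.
have bD : tvs_bounded D.
  move=> U /nbhs_tvsP[p cp pU]; have [M bM] := bnd p cp.
  have M1 : 0 < M + 1 by have := bounds_ge0 p M cp bM; lra.
  exists (toC (M + 1)); first by rewrite -toC0 toC_lt.
  move=> x Dx; exists ((toC (M + 1))^-1 *: x); last first.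
    by rewrite scalerA mulfV ?scale1r// toC_neq0.
  apply: pU; rewrite subr0 (seminormZ cp.1) modulusV modulus_toC_gt0//.
  by rewrite ltr_pdivrMl// mulr1; have := Dx p cp M bM; lra.
have cD : closed D.
  move=> x clx p cp M bM; rewrite leNgt; apply/negP => Mx.
  have e0 : 0 < p x - M by rewrite subr_gt0.
  have [y [Dy /= yx]] := clx _ (nbhs_seminorm_ball x cp e0).
  have := Dy p cp M bM; have := seminormB cp.1 y (y - x).
  by rewrite opprB addrC subrK; lra.
have DD : disk D by split => //; exists 0.
pose q h := h^-1 *: (u h - u 0).
have qD h h' : h != 0 -> h' != 0 -> modulus h <= r / 2 -> modulus h' <= r / 2 ->
    exists2 s, D s & q h - q h' = (h - h') *: s.
  move=> h0 h'0 hr h'r; have [->|hh'] := eqVneq h h'.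
    by exists 0; rewrite // scaler0 subrr.
  exists (second_quot u h h'); first by move=> p cp M; apply; split.
  by rewrite /second_quot scalerA mulfV ?scale1r// subr_eq0.
pose hn (n : nat) : Cplx R := toC (r / 2 / n.+1%:R).
have hn0 n : 0 < r / 2 / n.+1%:R by rewrite divr_gt0.
have hn_neq0 n : hn n != 0 by exact: toC_neq0.
have mhn n : modulus (hn n) = r / 2 / n.+1%:R by rewrite modulus_toC_gt0.
have hnr n : modulus (hn n) <= r / 2.
  by rewrite mhn ler_pdivrMr ?ltr0n// ler_pMr// ler1n.
have hn_small (e : R) : 0 < e -> exists N : nat, forall n, (N <= n)%N -> modulus (hn n) <= e.
  move=> e0; exists (Num.bound (r / 2 / e)) => n Nn.
  rewrite mhn ler_pdivrMr ?ltr0n// [leRHS]mulrC -ler_pdivrMr//.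
  have q0 : 0 <= r / 2 / e by rewrite divr_ge0 ?(ltW e0) ?(ltW r2).
  apply: (le_trans (ltW (archi_boundP q0))).
  by rewrite ler_nat ltnW.
(* [q] itself need not take values in the span of [D], only its increments do *)
pose a (n : nat) := q (hn n) - q (hn 0).
have a_span n : disk_span D (a n).
  have [s Ds qs] := qD _ _ (hn_neq0 n) (hn_neq0 0) (hnr n) (hnr 0).
  by rewrite /a qs; exact: disk_spanZ.
have [|x0 span_x0 ax0] := lcE D DD cD a a_span.
  move=> e e0; have e20 : 0 < e / 2 by rewrite divr_gt0.
  have [N hN] := hn_small _ (divr_gt0 e20 (ltr0Sn R 1)).
  exists N => m n Nm Nn; have := hN _ Nm; have := hN _ Nn => hm hn'.
  rewrite /a opprB addrA subrK.
  have [s Ds ->] := qD _ _ (hn_neq0 m) (hn_neq0 n) (hnr m) (hnr n).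
  apply: (@le_lt_trans _ _ (e / 2)); last by lra.
  apply: (gauge_le acD) => //.
  by apply: (le_trans (modulusB _ _)); move: hm hn'; lra.
exists (x0 + q (hn 0)) => p cp M bM h h0 hr; have sp := cp.1.
have M0 := bounds_ge0 p M cp bM.
have near_l (e : R) : 0 < e -> exists N : nat, forall n, (N <= n)%N ->
    p (q (hn n) - (x0 + q (hn 0))) <= e * M.
  move=> e0; have [N hN] := ax0 e e0; exists N => n Nn.
  have -> : q (hn n) - (x0 + q (hn 0)) = a n - x0 by rewrite opprD addrA addrAC.
  have [t [t0 te [v Dv ->]]] :=
    gauge_lt (disk_span_sub_scale acD (a_span n) span_x0) (hN n Nn).
  rewrite (seminormZ sp) modulus_toC_gt0// ler_pM ?(seminorm_ge0 sp) ?(ltW t0) ?(ltW te)//.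
  exact: Dv.
apply/ler_addgt0Pr => e e0.
have M20 : 0 < 2 * M + 1 by lra.
have e'0 : 0 < e / (2 * M + 1) by rewrite divr_gt0.
have [N1 N1P] := near_l _ e'0; have [N2 N2P] := hn_small _ e'0.
pose n := maxn N1 N2; have := N1P n (leq_maxl _ _); have := N2P n (leq_maxr _ _).
have [s Ds qs] := qD _ _ h0 (hn_neq0 n) hr (hnr n).
move=> hne ple; rewrite (le_trans (seminorm_tri sp (q (hn n)) _ _))//.
rewrite -/(q h) qs (seminormZ sp).
have ms : modulus (h - hn n) * p s <= (modulus h + e / (2 * M + 1)) * M.
  rewrite ler_pM ?modulus_ge0 ?(seminorm_ge0 sp)//; last exact: Ds.
  by rewrite (le_trans (modulusB _ _))// lerD2l.
apply: (le_trans (lerD ms ple)).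
have : e / (2 * M + 1) * (2 * M) <= e.
  by rewrite mulrAC ler_pdivrMr// ler_pM2l//; lra.
by move: (e / _) => y; nra.
Qed.

End LocalCompleteness.

(** * Smoothness *)

Section Assembly.
Context {R : realType}.
Implicit Types (E F : tvsType (Cplx R)) (h : Cplx R) (r e M : R).

Section Embedding.
Context {E F : tvsType (Cplx R)} (i : {linear E -> F}).
Hypothesis i_top : forall U : set E, open U <-> exists2 V : set F, open V & i @^-1` V = U.

Lemma cont_seminorm_comp (q : F -> R) :
  cont_seminorm q -> cont_seminorm (fun x => q (i x)).
Proof.
move=> [sq nq]; split.
  by split=> [x y|a x]; rewrite ?linearD ?linearZ ?(seminormD sq) ?(seminormZ sq).
move: nq; rewrite nbhsE => -[V [oV V0] Vq]; rewrite nbhsE.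
exists (i @^-1` V); last by move=> x; exact: Vq.
by split; [apply/i_top; exists V|rewrite /= linear0].
Qed.

(** The seminorms restricted from [F] are cofinal, because [E] carries the induced
    topology. *)
Lemma cont_seminorm_dominated (p : E -> R) : cont_seminorm p ->
  exists2 q : F -> R, cont_seminorm q & forall x, p x <= q (i x).
Proof.
move=> [sp]; rewrite nbhsE => -[U [/i_top[V oV VU] U0] Up].
have nV : nbhs 0 V.
  by apply: open_nbhs_nbhs; split => //; move: U0; rewrite -VU /= linear0.
have [q cq qV] := nbhs0_seminorm nV; exists q => // x; rewrite leNgt; apply/negP => qp.
have p0 : 0 < p x := le_lt_trans (seminorm_ge0 cq.1 _) qp.
have : U ((toC (p x))^-1 *: x).
  rewrite -VU /=; apply: qV; rewrite linearZ (seminormZ cq.1) modulusV.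
  by rewrite modulus_toC_gt0// ltr_pdivrMl// mulr1.
move=> /Up /=; rewrite (seminormZ sp) modulusV modulus_toC_gt0//.
by rewrite mulVf ?ltxx// gt_eqF.
Qed.

Lemma linear_quot a (x y : E) : i (a *: (x - y)) = a *: (i x - i y).
Proof. by rewrite linearZ_LR linearB. Qed.

Lemma second_quot_linear (u : Cplx R -> E) h h' :
  second_quot (fun z => i (u z)) h h' = i (second_quot u h h').
Proof.
by rewrite /second_quot !linear_quot.
Qed.

End Embedding.

Section Partial.
Context {d : nat} {E : tvsType (Cplx R)} (E_hausdorff : hausdorff_space E).
Implicit Types (z w : 'rV[Cplx R]_d) (j k : 'I_d).

Lemma partial_eq (f : 'rV[Cplx R]_d -> E) j z l :
  partial_quot j f z h @[h --> (0 : Cplx R)^'] --> l -> partial j f z = l.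
Proof.
move=> fl; apply: xget_subset1 => // x y; apply: (cvg_unique E_hausdorff).
Qed.

Lemma partial_quotE (f : 'rV[Cplx R]_d -> E) j z h : partial_quot j f z h =
  h^-1 *: (f (z + h *: delta_mx 0 j) - f (z + 0 *: delta_mx 0 j)).
Proof. by rewrite scale0r addr0. Qed.

(** Local completeness turns bounds on the second divided differences into the
    existence of a partial derivative, with a rate of convergence. *)
Lemma partial_rate (E_lc : locally_complete E) (f : 'rV[Cplx R]_d -> E) z j r :
  0 < r ->
  (forall p : E -> R, cont_seminorm p -> exists M, forall h h', admissible r h h' ->
     p (second_quot (fun x => f (z + x *: delta_mx 0 j)) h h') <= M) ->
  partial_quot j f z h @[h --> (0 : Cplx R)^'] --> partial j f z /\
  forall p : E -> R, cont_seminorm p -> forall M,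
    (forall h h', admissible r h h' ->
       p (second_quot (fun x => f (z + x *: delta_mx 0 j)) h h') <= M) ->
    forall h, h != 0 -> modulus h <= r / 2 ->
      p (partial_quot j f z h - partial j f z) <= M * modulus h.
Proof.
move=> r0 bnd; have [l lP] := locally_complete_diff_quot E_lc r0 bnd.
have fl : partial_quot j f z h @[h --> (0 : Cplx R)^'] --> l.
  apply/cvg_dnbhs0P => p cp e e0; have [M bM] := bnd p cp.
  have M1 : 0 < `|M| + 1 by have := normr_ge0 M; lra.
  exists (Num.min (r / 2) (e / (`|M| + 1))).
    by rewrite lt_min !divr_gt0.
  move=> h h0; rewrite lt_min => /andP[hr he].
  rewrite partial_quotE; apply: (le_lt_trans (lP p cp M bM h h0 (ltW hr))).
  move: he; rewrite ltr_pdivlMr//; apply: le_lt_trans; rewrite mulrC ler_wpM2l ?modulus_ge0//.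
  by have := ler_norm M; lra.
rewrite (partial_eq fl); split => // p cp M bM h h0 hr.
by rewrite partial_quotE; exact: lP bM h h0 hr.
Qed.

End Partial.

Lemma polyball_disc d (Omega : set 'rV[Cplx R]_d) z k r : 0 < r ->
  polyball z (2 * r) `<=` Omega ->
  forall x, modulus x <= r -> Omega (line z k x).
Proof.
move=> r0 zO x xr; apply: zO; have -> : 2 * r = r / 2 + (3 / 2) * r by field.
apply: polyball_line; last by lra.
by apply: polyball_center; rewrite divr_gt0.
Qed.

(** The Cauchy estimate in [F] bounds the second divided differences of [f] in [E],
    where local completeness provides the partial derivatives; by uniqueness of
    limits these are sent to [G], whose continuity they inherit. *)
Lemma has_C1_descend d (E F : tvsType (Cplx R)) (i : {linear E -> F})
    (Omega : set 'rV[Cplx R]_d) (f : 'rV[Cplx R]_d -> E) G :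
  (forall U : set E, open U <-> exists2 V : set F, open V & i @^-1` V = U) ->
  hausdorff_space E -> hausdorff_space F -> locally_complete E -> open Omega ->
  (forall z, Omega z -> {for z, continuous (fun z => i (f z))}) ->
  has_C1 Omega (fun z => i (f z)) G ->
  has_C1 Omega f (fun j => partial j f).
Proof.
move=> i_top hE hF lcE oO fc fG.
have iquot j z h : partial_quot j (fun z => i (f z)) z h = i (partial_quot j f z h).
  by rewrite /partial_quot linear_quot.
have ex z (Oz : Omega z) j :
    partial_quot j f z h @[h --> (0 : Cplx R)^'] --> partial j f z.
  have [rho rho0 rhoO] := open_polyball oO Oz.
  have r0 : 0 < rho / 2 by rewrite divr_gt0.
  have dO := @polyball_disc _ Omega z j (rho / 2) r0.
  rewrite mulrC divfK// in dO; have {}dO := dO rhoO.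
  apply: (proj1 (partial_rate hE lcE r0 _)) => p cp.
  have [q cq pq] := cont_seminorm_dominated i_top cp.
  have [M bM] := bounded_line cq fc dO.
  exists (4 * M / (rho / 2) ^+ 2) => h h' [h0 h'0 hh' hr h'r].
  apply: (le_trans (pq _)); rewrite -second_quot_linear.
  apply: (cauchy_estimate cq.1 r0 _ bM) => //.
  exact: unif_diff_line cq oO fG dO.
have iG z (Oz : Omega z) j : i (partial j f z) = G j z.
  rewrite -(partial_eq hF (fG z Oz j).1); apply/esym/partial_eq => //.
  apply/cvg_dnbhs0P => q cq e e0.
  have [delta d0 dP] := (cvg_dnbhs0P _ _).1 (ex z Oz j) _ (cont_seminorm_comp i_top cq) e e0.
  by exists delta => // h h0 hd; rewrite iquot -linearB; exact: dP.
move=> z Oz j; split; first exact: ex.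
apply/cvg_rvP => p cp e e0.
have [q cq pq] := cont_seminorm_dominated i_top cp.
have [delta d0 dP] := (cvg_rvP _ _).1 (fG z Oz j).2 q cq e e0.
have [rho rho0 rhoO] := open_polyball oO Oz.
exists (Num.min rho delta) => [|w zw]; first by rewrite lt_min rho0.
have Ow : Omega w.
  by apply: rhoO => k; apply: (lt_le_trans (zw k)); rewrite ge_min lexx.
apply: (le_lt_trans (pq _)); rewrite linearB !iG//; apply: dP => k.
by apply: (lt_le_trans (zw k)); rewrite ge_min lexx orbT.
Qed.

(** The Cauchy estimate for [partial j f] gives existence of its partial derivatives;
    its constant being uniform near a point, they are limits of difference quotients
    at a locally uniform rate, hence continuous. *)
Lemma has_C1_partial d (E : tvsType (Cplx R))
    (Omega : set 'rV[Cplx R]_d) (f : 'rV[Cplx R]_d -> E) j :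
  hausdorff_space E -> locally_complete E -> open Omega ->
  has_C1 Omega f (fun j => partial j f) ->
  has_C1 Omega (partial j f) (fun k => partial k (partial j f)).
Proof.
move=> hE lcE oO fC1; set g := partial j f.
have gc z : Omega z -> {for z, continuous g} by move=> Oz; exact: (fC1 z Oz j).2.
have rate z k r : 0 < r -> (forall x, modulus x <= r -> Omega (line z k x)) ->
    partial_quot k g z h @[h --> (0 : Cplx R)^'] --> partial k g z /\
    forall (p : E -> R) M, cont_seminorm p ->
      (forall x, modulus x <= r -> p (g (line z k x)) <= M) ->
      forall h, h != 0 -> modulus h <= r / 2 ->
        p (partial_quot k g z h - partial k g z) <= 4 * M / r ^+ 2 * modulus h.
  move=> r0 dO; have [|gl rt] := @partial_rate _ _ hE lcE g z k r r0.
    move=> p cp; have [M bM] := bounded_line cp gc dO.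
    exists (4 * M / r ^+ 2) => h h' [h0 h'0 hh' hr h'r].
    exact: (cauchy_estimate_partial cp oO fC1 r0 dO bM).
  split=> // p M cp bM; apply: rt => // h h' [h0 h'0 hh' hr h'r].
  exact: (cauchy_estimate_partial cp oO fC1 r0 dO bM).
move=> z Oz k; have [rho rho0 rhoO] := open_polyball oO Oz.
split.
  have r0 : 0 < rho / 2 by rewrite divr_gt0.
  apply: (proj1 (rate z k (rho / 2) r0 _)); apply: polyball_disc => //.
  by rewrite mulrC divfK.
apply/cvg_rvP => p cp e e0; have sp := cp.1.
have [delta1 d10 gz1] := (cvg_rvP _ _).1 (gc z Oz) p cp 1 ltr01.
pose M := p (g z) + 1.
have M0 : 0 < M by rewrite ltr_wpDl// (seminorm_ge0 sp).
(* discs of radius [r] around points at distance less than [2 * r] from [z] stay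
   where [p \o g] is at most [M] *)
pose r := Num.min rho delta1 / 4.
have r0 : 0 < r by rewrite divr_gt0// lt_min rho0.
have r4 : 4 * r <= rho by rewrite /r mulrC divfK// ge_min lexx.
have r4' : 4 * r <= delta1 by rewrite /r mulrC divfK// ge_min lexx orbT.
have near w : polyball z (2 * r) w -> forall x, modulus x <= r ->
    Omega (line w k x) /\ p (g (line w k x)) <= M.
  move=> zw x xr; have zwx : polyball z (4 * r) (line w k x).
    by rewrite (_ : 4 * r = 2 * r + 2 * r); [apply: polyball_line => //; lra|ring].
  split; first by apply: rhoO; exact: polyball_le zwx.
  have : p (g (line w k x) - g z) < 1.
    by apply: gz1 => l; exact: lt_le_trans (zwx l) r4'.
  by have := seminormD sp (g (line w k x) - g z) (g z); rewrite subrK /M; lra.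
pose C := 4 * M / r ^+ 2.
have C0 : 0 < C by rewrite divr_gt0 ?exprn_gt0// mulr_gt0.
(* a step [t] for which the quotients are within [e / 4] of their limits *)
pose t : R := Num.min (r / 2) (e / (4 * C)).
have t0 : 0 < t.
  rewrite lt_min; apply/andP; split; first by rewrite divr_gt0.
  by rewrite divr_gt0// pmulr_rgt0.
have tr : t <= r / 2 by rewrite ge_min lexx.
have te : C * t <= e / 4.
  have tC : t * (4 * C) <= e.
    have c4 : 0 < 4 * C by rewrite pmulr_rgt0.
    by rewrite -(ler_pdivlMr _ _ c4) ge_min lexx orbT.
  by have -> : C * t = t * (4 * C) / 4; [field|rewrite ler_pM2r].
have approx w : polyball z (2 * r) w ->
    p (partial_quot k g w (toC t) - partial k g w) <= e / 4.
  move=> zw; have dO x : modulus x <= r -> Omega (line w k x).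
    by move=> xr; have [] := near w zw x xr.
  have [_ rt] := rate w k r r0 dO.
  apply: (le_trans _ te).
  rewrite -[in leRHS](modulus_toC_gt0 t0); apply: rt; rewrite ?toC_neq0 ?modulus_toC_gt0//.
  by move=> x xr; have [] := near w zw x xr.
have et0 : 0 < e / 8 * t by rewrite mulr_gt0 ?divr_gt0.
have [delta2 d20 gz2] := (cvg_rvP _ _).1 (gc z Oz) p cp _ et0.
have zz : polyball z (2 * r) z by apply: polyball_center; rewrite mulr_gt0.
have Ozt : Omega (line z k (toC t)).
  by have [] := near z zz (toC t) _; rewrite ?modulus_toC_gt0//; lra.
have [delta3 d30 gz3] := (cvg_rvP _ _).1 (gc _ Ozt) p cp _ et0.
exists (Num.min (2 * r) (Num.min delta2 delta3)).
  by rewrite !lt_min d20 d30 mulr_gt0.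
move=> w zw; have zw1 : polyball z (2 * r) w.
  by move=> l; have := zw l; rewrite !lt_min => /and3P[].
have g2 : p (g w - g z) < e / 8 * t.
  by apply: gz2 => l; have := zw l; rewrite !lt_min => /and3P[].
have g3 : p (g (line w k (toC t)) - g (line z k (toC t))) < e / 8 * t.
  apply: gz3 => l; rewrite !lineE opprD addrACA subrr addr0.
  by have := zw l; rewrite !lt_min => /and3P[].
have qq : p (partial_quot k g w (toC t) - partial_quot k g z (toC t)) <= e / 4.
  rewrite /partial_quot -scalerBr subrACA (seminormZ sp) modulusV modulus_toC_gt0//.
  by rewrite ler_pdivrMl// (le_trans (seminormB sp _ _))//; move: g2 g3; lra.
have a1 := approx w zw1; have a2 := approx z zz.
apply: (le_lt_trans (seminorm_tri sp (partial_quot k g w (toC t)) _ _)).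
have := seminorm_tri sp (partial_quot k g z (toC t)) (partial_quot k g w (toC t)) (partial k g z).
by rewrite (seminormBC sp (partial k g w)); move: a1 a2 qq; lra.
Qed.

Section CInfty.
Context {d : nat} {E : tvsType (Cplx R)}.
Variables (Omega : set 'rV[Cplx R]_d) (oO : open Omega).

Lemma within_openP (X : topologicalType) (g : 'rV[Cplx R]_d -> X) :
  {within Omega, continuous g} <-> forall z, Omega z -> {for z, continuous g}.
Proof.
rewrite continuous_open_subspace//; split=> gc z.
  by move=> Oz; apply: gc; rewrite inE.
by rewrite inE; exact: gc.
Qed.

Lemma in_Cinfty_of_C1 (f : 'rV[Cplx R]_d -> E) :
  hausdorff_space E -> locally_complete E ->
  (forall z, Omega z -> {for z, continuous f}) ->
  has_C1 Omega f (fun j => partial j f) -> in_Cinfty Omega f.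
Proof.
move=> hE lcE fc fC1; split.
  move=> k; elim: k f fc fC1 => //= k ih f fc fC1; split.
    by move=> z j Oz; exists (partial j f z); exact: (fC1 z Oz j).1.
  move=> j; apply: ih; last exact: has_C1_partial.
  by move=> z Oz; exact: (fC1 z Oz j).2.
have iter js : has_C1 Omega (iter_partial js f) (fun j => partial j (iter_partial js f)).
  by elim: js => //= j js; exact: has_C1_partial.
by case=> [|j js]; apply/within_openP => // z Oz; exact: (iter js z Oz j).2.
Qed.

Lemma C1_of_in_Cinfty (f : 'rV[Cplx R]_d -> E) : hausdorff_space E ->
  in_Cinfty Omega f -> has_C1 Omega f (fun j => partial j f).
Proof.
move=> hE [fD fc] z Oz j; split; last exact: (within_openP _).1 (fc [:: j]) z Oz.
have [/(_ z j Oz)[l fl] _] := fD 1%N.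
by rewrite (partial_eq hE fl).
Qed.

End CInfty.
End Assembly.

(** * The total derivative *)

Section TotalDerivative.
Context {R : realType} {d : nat}.
Implicit Types (F : tvsType (Cplx R)) (v w z : 'rV[Cplx R]_d) (j k : 'I_d).

Lemma euclidean_sq v :
  modulus (euclidean_norm v) ^+ 2 = \sum_(j < d) modulus (v 0 j) ^+ 2.
Proof.
rewrite -modulusX sqrtCK; apply: (@toC_inj R); rewrite -normE ger0_norm; last first.
  by apply: sumr_ge0 => j _; rewrite exprn_ge0.
rewrite /toC rmorph_sum; apply: eq_bigr => j _.
by rewrite normE -[RHS]/(toC _) !expr2 toCM.
Qed.

Lemma euclidean_ge v k : modulus (v 0 k) <= modulus (euclidean_norm v).
Proof.
rewrite -(ler_pXn2r (n := 2))// ?nnegrE ?modulus_ge0// euclidean_sq (bigD1 k)//=.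
by rewrite lerDl sumr_ge0// => j _; rewrite sqr_ge0.
Qed.

Lemma euclidean_le v : modulus (euclidean_norm v) <= \sum_(j < d) modulus (v 0 j).
Proof.
have s0 (P : pred 'I_d) : 0 <= \sum_(j < d | P j) modulus (v 0 j).
  by apply: sumr_ge0 => j _; exact: modulus_ge0.
rewrite -(ler_pXn2r (n := 2))// ?nnegrE ?modulus_ge0// euclidean_sq.
rewrite expr2 mulr_suml ler_sum// => j _; rewrite expr2 ler_wpM2l ?modulus_ge0//.
by rewrite (bigD1 j)//= lerDl.
Qed.

Lemma euclidean_axis k (h : Cplx R) :
  modulus (euclidean_norm (h *: (delta_mx 0 k : 'rV[Cplx R]_d))) = modulus h.
Proof.
apply/eqP; rewrite -(eqrXn2 (n := 2)) ?modulus_ge0// euclidean_sq (bigD1 k)//=.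
rewrite big1 ?addr0 => [|j jk]; last by rewrite !mxE eqxx /= (negPf jk) mulr0 modulus0 expr0n.
by rewrite !mxE !eqxx mulr1.
Qed.

Lemma linear_rowE F (l : {linear 'rV[Cplx R]_d -> F}) v :
  l v = \sum_(j < d) v 0 j *: l (delta_mx 0 j).
Proof. by rewrite {1}[v]row_sum_delta linear_sum; apply: eq_bigr => j _; rewrite linearZ. Qed.

Definition from_axes F (a : 'I_d -> F) v : F := \sum_(j < d) v 0 j *: a j.

Lemma from_axes_is_linear F (a : 'I_d -> F) : linear (from_axes a).
Proof.
move=> c u v; rewrite /from_axes scaler_sumr -big_split; apply: eq_bigr => j _ /=.
by rewrite !mxE scalerDl scalerA.
Qed.
HB.instance Definition _ F (a : 'I_d -> F) :=
  GRing.isLinear.Build (Cplx R) 'rV[Cplx R]_d F _ (from_axes a) (from_axes_is_linear a).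

(** The partial derivatives taken in [F] are the values of the total derivative on
    the axes. Continuity follows because a linear map on a finite-dimensional space is
    bounded for every seminorm. *)
Lemma holomorphic_C1 (E F : tvsType (Cplx R)) (i : {linear E -> F}) 
    (Omega : set 'rV[Cplx R]_d) f :
  open Omega -> holomorphic i Omega f -> 
  (forall z, Omega z -> {for z, continuous (fun z => i (f z))}) /\
  exists G, has_C1 Omega (fun z => i (f z)) G.
Proof.
move=> oO [df [dfP dfc]].
have eps z (Oz : Omega z) (q : F -> R) (cq : cont_seminorm q) (e : R) (e0 : 0 < e) :
    exists2 delta : R, 0 < delta & forall w, polyball z delta w -> Omega w ->
      q (i (f w) - i (f z) - df z (w - z)) <= e * modulus (euclidean_norm (w - z)).
  have FF : Filter (within [set w | Omega w /\ w != z] (nbhs z)).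
    exact: within_filter.
  have := (cvg_tvsP FF _ _).1 (dfP z Oz) q cq e e0.
  move=> /nbhs_rvP[delta d0 dP]; exists delta => // w zw Ow.
  have [->|wz] := eqVneq w z.
    rewrite !subrr linear0 subr0 (seminorm0 cq.1) mulr_ge0 ?modulus_ge0//.
    exact: ltW.
  have := dP w zw (conj Ow wz); rewrite subr0 (seminormZ cq.1) modulusV.
  have m0 : 0 < modulus (euclidean_norm (w - z)).
    rewrite lt_neqAle modulus_ge0 andbT eq_sym; apply: contra_neq wz => m0.
    apply/eqP; rewrite -subr_eq0; apply/eqP/rowP => k; rewrite [RHS]mxE.
    apply/modulus0_eq0/eqP; rewrite eq_le modulus_ge0 andbT -[leRHS]m0.
    exact: euclidean_ge.
  by rewrite ltr_pdivrMl// => /ltW; rewrite mulrC.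
split.
  move=> z Oz; apply/cvg_rvP => q cq e e0; have sq := cq.1.
  have [delta d0 dP] := eps z Oz q cq 1 ltr01.
  have [rho rho0 rhoO] := open_polyball oO Oz.
  pose K := 1 + \sum_(j < d) q (df z (delta_mx 0 j)).
  have K0 : 0 < K.
    by rewrite ltr_pwDl// sumr_ge0// => j _; exact: seminorm_ge0 sq _.
  have Kd0 : 0 < K * d.+1%:R by rewrite mulr_gt0.
  exists (Num.min delta (Num.min rho (e / (K * d.+1%:R)))).
    by rewrite !lt_min d0 rho0 divr_gt0.
  move=> w zw.
  have zw1 : polyball z delta w by move=> k; have := zw k; rewrite !lt_min => /and3P[].
  have zw2 : polyball z rho w by move=> k; have := zw k; rewrite !lt_min => /and3P[].
  have zw3 k : modulus ((w - z) 0 k) <= e / (K * d.+1%:R).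
    by have := zw k; rewrite !mxE !lt_min => /and3P[_ _ /ltW].
  have := dP w zw1 (rhoO _ zw2); rewrite mul1r => le1.
  rewrite -[i (f w) - i (f z)](subrK (df z (w - z))).
  apply: (le_lt_trans (seminormD sq _ _)).
  have le2 : q (df z (w - z)) <=
      \sum_(j < d) modulus ((w - z) 0 j) * q (df z (delta_mx 0 j)).
    rewrite {1}linear_rowE; apply: (le_trans (seminorm_sum sq _ _ _)).
    by apply: ler_sum => j _; rewrite (seminormZ sq).
  set s := \sum_(j < d) modulus ((w - z) 0 j).
  have s0 : 0 <= s by apply: sumr_ge0 => j _; exact: modulus_ge0.
  have le3 : \sum_(j < d) modulus ((w - z) 0 j) * q (df z (delta_mx 0 j)) <= s * (K - 1).
    rewrite /K addrAC subrr add0r mulr_sumr; apply: ler_sum => j _.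
    rewrite ler_wpM2r ?(seminorm_ge0 sq)// /s (bigD1 j)//= lerDl sumr_ge0// => k _.
    exact: modulus_ge0.
  have le4 : modulus (euclidean_norm (w - z)) <= s := euclidean_le _.
  have le5 : s * K < e.
    apply: (@le_lt_trans _ _ (d%:R * (e / (K * d.+1%:R)) * K)).
      rewrite ler_wpM2r ?(ltW K0)// /s.
      apply: (@le_trans _ _ (\sum_(j < d) e / (K * d.+1%:R))); first exact: ler_sum.
      by rewrite sumr_const card_ord -[leLHS]mulr_natl.
    have -> : d%:R * (e / (K * d.+1%:R)) * K = e * (d%:R / d.+1%:R).
      by field; rewrite ?pnatr_eq0 ?(gt_eqF K0)//= lt0r_neq0// ltr_pwDl.
    by rewrite gtr_pMr// ltr_pdivrMr// mul1r ltr_nat.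
  by move: le1 le2 le3 le4 le5; move: (modulus (euclidean_norm _)) => m; nra.
exists (fun j z => df z (delta_mx 0 j)) => z Oz j; split; last first.
  by apply: (within_openP oO _).1 Oz; exact: dfc.
apply/cvg_dnbhs0P => q cq e e0.
have e20 : 0 < e / 2 by rewrite divr_gt0.
have [delta d0 dP] := eps z Oz q cq _ e20.
have [rho rho0 rhoO] := open_polyball oO Oz.
exists (Num.min delta rho) => [|h h0]; first by rewrite lt_min d0.
rewrite lt_min => /andP[hd hr].
have ball_h a : modulus h < a -> polyball z a (z + h *: delta_mx 0 j).
  by move=> ha k; rewrite lineE addrAC subrr add0r (le_lt_trans (modulus_mulrb _ _)).
have := dP _ (ball_h _ hd) (rhoO _ (ball_h _ hr)).
rewrite [z + _]addrC addrK euclidean_axis linearZ => hP.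
have -> : partial_quot j (fun z => i (f z)) z h - df z (delta_mx 0 j) =
    h^-1 *: (i (f (h *: delta_mx 0 j + z)) - i (f z) - h *: df z (delta_mx 0 j)).
  by rewrite /partial_quot [z + _]addrC [RHS]scalerBr scalerA mulVf// scale1r.
rewrite (seminormZ cq.1) modulusV ltr_pdivrMl ?modulus_gt0//.
apply: (le_lt_trans hP); rewrite mulrC ltr_pM2l ?modulus_gt0//; lra.
Qed.

(** The corners of the path from [z] to [w] changing one coordinate at a time. *)
Definition staircase z w (n : nat) : 'rV[Cplx R]_d :=
  \row_j (if (j < n)%N then w 0 j else z 0 j).

Lemma polyball_staircase z w n rho : 0 < rho ->
  polyball z rho w -> polyball z rho (staircase z w n).
Proof.
by move=> rho0 zw k; rewrite mxE; case: ifP => _; rewrite ?zw// subrr modulus0.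
Qed.

Lemma staircaseS z w j : staircase z w j.+1 =
  staircase z w j + (w - z) 0 j *: delta_mx 0 j.
Proof.
apply/rowP => k; rewrite !mxE eqxx /= ltnS leq_eqVlt -val_eqE /=.
have [kj|] := eqVneq (val k) (val j); last by rewrite mulr0 addr0.
by rewrite (val_inj kj) ltnn /= mulr1 subrKC.
Qed.

(** The increments along the staircase path from [z] to [w] are linear up to [e] by
    strict differentiability, applied at [z] along every axis. *)
Lemma C1_holomorphic (E F : tvsType (Cplx R)) (i : {linear E -> F})
    (Omega : set 'rV[Cplx R]_d) f g :
  (forall U : set E, open U <-> exists2 V : set F, open V & i @^-1` V = U) ->
  open Omega -> has_C1 Omega f g -> holomorphic i Omega f.
Proof.
move=> i_top oO fg.
have iB x y : i (x - y) = i x - i y by rewrite linearB.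
exists (fun z => from_axes (fun j => i (g j z)) : {linear 'rV[Cplx R]_d -> F}).
split.
  move=> z Oz; have FF : Filter (within [set w | Omega w /\ w != z] (nbhs z)).
    exact: within_filter.
  apply/(cvg_tvsP FF) => q cq e e0.
  have cp := cont_seminorm_comp i_top cq.
  have e'0 : 0 < e / d.+1%:R by rewrite divr_gt0.
  pose strict j rho := forall w t,
    polyball z rho w -> polyball z rho (w + t *: delta_mx 0 j) ->
    q (i (f (w + t *: delta_mx 0 j) - f w - t *: g j z)) <= e / d.+1%:R * modulus t.
  have [rho rho0 rhoP] : exists2 rho : R, 0 < rho & forall j, strict j rho.
    apply: common_radius => [j a b b0 ba Pa w t zw zwt|j].
      by apply: Pa; exact: polyball_le ba _ _.
    exact: (strict_partial j cp oO fg Oz e'0).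
  apply/nbhs_rvP; exists rho => // w zw _ /=; rewrite subr0.
  set m := euclidean_norm (w - z).
  have -> : i (f w) - i (f z) - from_axes (fun j => i (g j z)) (w - z) =
      \sum_(j < d) i (f (staircase z w j.+1) - f (staircase z w j) -
                      (w - z) 0 j *: g j z).
    transitivity (i (\sum_(j < d) (f (staircase z w j.+1) - f (staircase z w j) -
                      (w - z) 0 j *: g j z))); last by rewrite linear_sum.
    rewrite sumrB iB; congr (_ - _); last first.
      by rewrite linear_sum; apply: eq_bigr => j _; rewrite linearZ.
    rewrite -(big_mkord xpredT (fun n => f (staircase z w n.+1) - f (staircase z w n))).
    rewrite telescope_sumr// iB; congr (i (f _) - i (f _)); apply/rowP => k.
      by rewrite mxE ltn_ord.
    by rewrite mxE.
  rewrite (seminormZ cq.1) modulusV.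
  have le1 : q (\sum_(j < d) i (f (staircase z w j.+1) - f (staircase z w j) -
                      (w - z) 0 j *: g j z)) <= d%:R * (e / d.+1%:R * modulus m).
    apply: (le_trans (seminorm_sum cq.1 _ _ _)).
    apply: (@le_trans _ _ (\sum_(j < d) e / d.+1%:R * modulus m)); last first.
      by rewrite sumr_const card_ord -[leLHS]mulr_natl.
    apply: ler_sum => j _; rewrite staircaseS.
    apply: (@le_trans _ _ (e / d.+1%:R * modulus ((w - z) 0 j))).
      by apply: rhoP; rewrite -?staircaseS; exact: polyball_staircase.
    by rewrite ler_wpM2l ?(ltW e'0)// euclidean_ge.
  have [m0|mn0] := eqVneq (modulus m) 0; first by rewrite m0 invr0 mul0r.
  have mgt0 : 0 < modulus m by rewrite lt0r mn0 modulus_ge0.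
  rewrite ltr_pdivrMl//; apply: (le_lt_trans le1).
  have -> : d%:R * (e / d.+1%:R * modulus m) = modulus m * (e * (d%:R / d.+1%:R)).
    by ring.
  by rewrite ltr_pM2l// gtr_pMr// ltr_pdivrMr// mul1r ltr_nat.
move=> v; apply/(within_openP oO) => z Oz; apply/cvg_rvP => q cq e e0.
have cp := cont_seminorm_comp i_top cq.
pose S := \sum_(j < d) modulus (v 0 j).
have S0 : 0 <= S by apply: sumr_ge0 => j _; exact: modulus_ge0.
have S1 : 0 < S + 1 by lra.
have e'0 : 0 < e / (S + 1) by rewrite divr_gt0.
have [rho rho0 rhoP] : exists2 rho : R, 0 < rho & forall j, forall w,
    polyball z rho w -> q (i (g j w - g j z)) <= e / (S + 1).
  apply: common_radius => [j a b b0 ba Pa w zw|j].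
    by apply: Pa; exact: polyball_le ba _ _.
  have [a a0 aP] := (cvg_rvP _ _).1 (fg z Oz j).2 _ cp _ e'0.
  by exists a => // w zw; rewrite ltW// aP.
exists rho => // w zw; rewrite /= /from_axes -sumrB.
apply: (le_lt_trans (seminorm_sum cq.1 _ _ _)).
apply: (@le_lt_trans _ _ (\sum_(j < d) modulus (v 0 j) * (e / (S + 1)))).
  apply: ler_sum => j _; rewrite -scalerBr -iB (seminormZ cq.1).
  by rewrite ler_wpM2l ?modulus_ge0// rhoP.
by rewrite -mulr_suml -/S mulrCA gtr_pMr// ltr_pdivrMr// mul1r; lra.
Qed.

End TotalDerivative.

Theorem corollary6p3 (R : realType) (E : tvsType (Cplx R))
    (Ehat : tvsType (Cplx R)) (i : {linear E -> Ehat})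
    (d : nat) (Omega : set 'rV[Cplx R]_d) (f : 'rV[Cplx R]_d -> E)
    (E_nontrivial : exists x : E, x != 0)
    (E_hausdorff : hausdorff_space E)
    (E_locally_complete : locally_complete E)
    (Ehat_completion : is_completion i)
    (Omega_open : open Omega) :
  holomorphic i Omega f <-> in_Cinfty Omega f.
Proof.
have [Ehat_hausdorff _ _ i_top _] := Ehat_completion.
split=> [f_hol|f_smooth]; last exact: C1_holomorphic (C1_of_in_Cinfty _ _ f_smooth).
have [fc [G fG]] := holomorphic_C1 Omega_open f_hol.
apply: in_Cinfty_of_C1 => //; last exact: has_C1_descend fc fG.
move=> z Oz; apply/cvg_rvP => p cp e e0.
have [q cq pq] := cont_seminorm_dominated i_top cp.
have [delta d0 dP] := (cvg_rvP _ _).1 (fc z Oz) q cq e e0.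
by exists delta => // w zw; apply: (le_lt_trans (pq _)); rewrite linearB dP.
Qed.
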